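(* Let $M^3$ be a Lagrangian submanifold of the homogeneous nearly Kähler sphere $\mathbb S^6(1)$. In a local oriented orthonormal frame, $$S_{ij,k}=P_{ijk}+P_{jik}+D_{ijk},\qquad D_{ijk}=\tfrac14\sum_m(\omega_{kim}S_{mj}+\omega_{kjm}S_{im}).$$ Moreover, $$\sum_{i,j,k}S_{ij,k}S_{ik,j}=|P|^2+3\sum_{i,j,k}P_{ijk}P_{jik}+\tfrac12\langle A,S\rangle+\tfrac1{16}(s^2-3q).$$
   Context: Everything is smooth. Identify $\mathbb R^7$ with the imaginary Cayley numbers with cross product $X\times Y=\tfrac12(XY-YX)$. The homogeneous nearly Kähler structure on $\mathbb S^6(1)\subset\mathbb R^7$ is the round metric $\langle\cdot,\cdot\rangle$ with $J_xX=x\times X$. Let $\overline\nabla$ be its Levi-Civita connection and $G(X,Y)=(\overline\nabla_XJ)Y$. A Lagrangian submanifold is an immersed 3-manifold $M^3$ with the induced metric such that $J(TM)=T^\perp M$. Let $\nabla,\nabla^\perp$ be the Levi-Civita and normal connections, $h(X,Y)=\overline\nabla_XY-\nabla_XY$ the second fundamental form, and $A_\xi$ the shape operator, $\langle A_\xi X,Y\rangle=\langle h(X,Y),\xi\rangle$. It is known that $M$ is orientable and minimal and that $G(X,Y)$ is normal for tangent $X,Y$. The form $\omega(X,Y,Z)=\langle G(X,Y),JZ\rangle$ is the volume form of $M$ for a suitable orientation, which is fixed. In a local oriented orthonormal frame $\{e_1,e_2,e_3\}$: $\omega_{ijk}=\omega(e_i,e_j,e_k)$ (so $\omega_{123}=1$);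 $h_{ijk}=\langle h(e_i,e_j),Je_k\rangle$ (known to be totally symmetric and trace-free); $S_{ij}=\sum_{a,b}h_{abi}h_{abj}$, $s=|h|^2=\operatorname{tr}S$, $q=\operatorname{tr}(S^2)$; $S_{ij,k}=(\nabla_{e_k}S)(e_i,e_j)$. Set $(\nabla h)(X,Y,Z)=\nabla^\perp_Xh(Y,Z)-h(\nabla_XY,Z)-h(Y,\nabla_XZ)$ and $$T(X,Y,Z)=(\nabla h)(X,Y,Z)-\tfrac14\{G(X,A_{JZ}Y)+G(Y,A_{JX}Z)+G(Z,A_{JY}X)\},$$ $T_{lijk}=\langle T(e_l,e_i,e_j),Je_k\rangle$ (a totally symmetric trace-free tensor). Define $$P_{ijk}=\sum_{a,b}h_{abi}T_{abjk},\quad W_{ij}=\sum_{a,b}\omega_{iab}P_{abj},\quad A_{ij}=\tfrac12(W_{ij}+W_{ji}),$$ with $|P|^2=\sum_{i,j,k} P_{ijk}^2$ and $\langle A,S\rangle=\sum_{i,j}A_{ij}S_{ij}$. (The matrix $A=(A_{ij})$ is not to be confused with the shape operator $A_\xi$.) *)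

(* Defs.v *)
From HB Require Import structures.
From mathcomp Require Import all_boot all_order all_algebra ring lra.
From mathcomp Require Import all_classical all_reals all_analysis.

Set Implicit Arguments.
Unset Strict Implicit.
Unset Printing Implicit Defensive.

Import Order.TTheory GRing.Theory Num.Theory.
Import numFieldNormedType.Exports.

Local Open Scope classical_set_scope.
Local Open Scope ring_scope.

Section CayleyDickson.
Variable A : zmodType.
Variables (mul : A -> A -> A) (conj : A -> A).

Definition cd_conj (x : A * A) : A * A := (conj x.1, - x.2).

Definition cd_mul (x y : A * A) : A * A :=
  (mul x.1 y.1 - mul (conj y.2) x.2, mul y.2 x.1 + mul x.2 (conj y.1)).

End CayleyDickson.

Section Cayley.
Variable R : realType.

Definition complexn : Type := (R * R)%type.
Definition quaternion : Type := (complexn * complexn)%type.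
Definition octonion : Type := (quaternion * quaternion)%type.

Definition cmul : complexn -> complexn -> complexn := cd_mul *%R id.
Definition cconj : complexn -> complexn := cd_conj id.
Definition qmul : quaternion -> quaternion -> quaternion := cd_mul cmul cconj.
Definition qconj : quaternion -> quaternion := cd_conj cconj.
Definition omul : octonion -> octonion -> octonion := cd_mul qmul qconj.

Definition oct_of_im (x : 'rV[R]_7) : octonion :=
  let c k (lt_k7 : (k < 7)%N) := x 0 (Ordinal lt_k7) in
  (((0, c 0 isT), (c 1 isT, c 2 isT)),
   ((c 3 isT, c 4 isT), (c 5 isT, c 6 isT))).

Definition im_of_oct (z : octonion) : 'rV[R]_7 :=
  \row_i nth 0 [:: z.1.1.2; z.1.2.1; z.1.2.2;
                   z.2.1.1; z.2.1.2; z.2.2.1; z.2.2.2] i.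

(* x y - y x is purely imaginary, so that im_of_oct loses no information. *)
Definition cross (x y : 'rV[R]_7) : 'rV[R]_7 :=
  2^-1 *: im_of_oct (omul (oct_of_im x) (oct_of_im y)
                     - omul (oct_of_im y) (oct_of_im x)).

Definition dot (x y : 'rV[R]_7) : R := \sum_i x 0 i * y 0 i.

End Cayley.

Section Smooth.
Variables (R : realType) (V W : normedModType R).

Fixpoint Ck (k : nat) (U : set V) (f : V -> W) : Prop :=
  if k is k'.+1 then
    (forall x, U x -> differentiable f x) /\ forall v, Ck k' U ('D_v f)
  else forall x, U x -> {for x, continuous f}.

Definition smooth_on (U : set V) (f : V -> W) : Prop := forall k, Ck k U f.

End Smooth.

Section Manifold.
Variables (R : realType) (M : topologicalType).

Record chart := Chart {
  chart_dom : set M;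
  chart_map : M -> 'rV[R]_3;
  chart_inv : 'rV[R]_3 -> M;
  chart_dom_open : open chart_dom;
  chart_img_open : open (chart_map @` chart_dom);
  chart_mapK : {in chart_dom, cancel chart_map chart_inv};
  chart_map_continuous : {within chart_dom, continuous chart_map};
  chart_inv_continuous :
    {within chart_map @` chart_dom, continuous chart_inv} }.

Definition chart_img (c : chart) : set 'rV[R]_3 := chart_map c @` chart_dom c.

Record manifold3 := Manifold3 {
  atlas : set chart;
  manifold_hausdorff : hausdorff_space M;
  manifold_second_countable : @second_countable M;
  atlas_cover : forall p, exists2 c, atlas c & chart_dom c p;
  atlas_compat : forall c c', atlas c -> atlas c' ->
    smooth_on (chart_map c @` (chart_dom c `&` chart_dom c'))
              (chart_map c' \o chart_inv c) }.

End Manifold.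

Section NearlyKaehlerSphere.
Variable R : realType.
Implicit Types x X Y : 'rV[R]_7.

Definition sphere6 : set 'rV[R]_7 := [set x | dot x x = 1].

(* The almost complex structure J_x of the sphere. *)
Definition acs x X : 'rV[R]_7 := cross x X.

(* The Levi-Civita connection of the round sphere is the part tangent to the
   sphere of the flat derivative of R^7.  It is given here for a vector field Y
   along a map c : E -> S^6, differentiated at a in the direction v; the choice
   c = id is the connection on vector fields of the sphere itself. *)
Definition nablaS (E : normedModType R) (c Y : E -> 'rV[R]_7) (a v : E) :
    'rV[R]_7 :=
  let w := 'D_v Y a in w - dot w (c a) *: c a.

(* A vector field that is tangent to the sphere and has value Y at x, for Y
   tangent to the sphere at x. *)
Definition tangent_ext Y (z : 'rV[R]_7) : 'rV[R]_7 := Y - dot Y z *: z.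

(* (nabla_X J) Y = nabla_X (J Y) - J (nabla_X Y); it is tensorial in Y, so that
   any vector field extending Y may be used. *)
Definition Gtensor x X Y : 'rV[R]_7 :=
  nablaS id (fun z => acs z (tangent_ext Y z)) x X
  - acs x (nablaS id (tangent_ext Y) x X).

End NearlyKaehlerSphere.

(* nablaS takes values tangent to the sphere, is metric and is torsion free:
   it is the Levi-Civita connection. *)
Section SphereConnection.
Variable R : realType.
Implicit Types x X : 'rV[R]_7.

Lemma dotC (x y : 'rV[R]_7) : dot x y = dot y x.
Proof. by apply: eq_bigr => i _; rewrite mulrC. Qed.

Lemma dotDl (x y z : 'rV[R]_7) : dot (x + y) z = dot x z + dot y z.
Proof. by rewrite /dot -big_split; apply: eq_bigr => i _; rewrite mxE mulrDl. Qed.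

Lemma dotZl a (x z : 'rV[R]_7) : dot (a *: x) z = a * dot x z.
Proof. by rewrite /dot mulr_sumr; apply: eq_bigr => i _; rewrite mxE mulrA. Qed.

Lemma dotBl (x y z : 'rV[R]_7) : dot (x - y) z = dot x z - dot y z.
Proof. by rewrite dotDl -scaleN1r dotZl mulN1r. Qed.

Lemma derive_dot (E : normedModType R) (Y Z : E -> 'rV[R]_7) (a v : E) :
  derivable Y a v -> derivable Z a v ->
  'D_v (fun z => dot (Y z) (Z z)) a =
  dot ('D_v Y a) (Z a) + dot (Y a) ('D_v Z a).
Proof.
move=> dY dZ; have cY i := (derivable_mxP Y a v).1 dY 0 i.
have cZ i := (derivable_mxP Z a v).1 dZ 0 i.
rewrite (_ : (fun z => _) = \sum_i (fun z => Y z 0 i * Z z 0 i)); last first.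
  by apply/funext => z; rewrite fct_sumE.
rewrite derive_sum; last by move=> i; exact: derivableM.
rewrite /dot -big_split; apply: eq_bigr => i _ /=.
rewrite deriveM// !derive_mx// !mxE /= addrC; congr (_ + _).
by rewrite /GRing.scale /= mulrC.
Qed.

(* Vector fields on the sphere, given by an extension to R^7. *)
Definition tangent_field (Y : 'rV[R]_7 -> 'rV[R]_7) :=
  forall x, sphere6 x -> differentiable Y x /\ dot (Y x) x = 0.

Lemma derive_tangent_field Y x X :
  tangent_field Y -> sphere6 x -> dot X x = 0 ->
  dot ('D_X Y x) x = - dot (Y x) X.
Proof.
move=> tY Sx Xx.
pose N := dot X X / 4.
have N0 : 0 <= N by rewrite divr_ge0// sumr_ge0// => i _; rewrite -expr2 sqr_ge0.
have den (t : R) : 1 + N * t ^+ 2 != 0.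
  by rewrite gt_eqF// ltr_pwDl// mulr_ge0// sqr_ge0.
pose b (t : R) : R := (1 + N * t ^+ 2)^-1.
pose c (t : R) : 'rV[R]_7 := (b t * (1 - N * t ^+ 2)) *: x + (b t * t) *: X.
have b0 : b 0 = 1 by rewrite /b expr0n /= mulr0 addr0 invr1.
have c0 : c 0 = x.
  by rewrite /c b0 expr0n /= !mulr0 subr0 mulr1 scale1r scale0r addr0.
have Sc t : sphere6 (c t).
  rewrite /sphere6 /= /c dotDl !dotZl !(dotC _ (_ + _)) !dotDl !dotZl.
  rewrite (dotC x X) Xx Sx /b.
  have -> : dot X X = 4 * N by rewrite /N mulrC divfK.
  by field; exact: den.
have der_b : is_derive (0 : R) (1 : R) b 0.
  have d1 : is_derive (0 : R) (1 : R) (fun t => 1 + N * t ^+ 2) 0.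
    apply: is_derive_eq; rewrite /GRing.scale /= /cst; lra.
  have der : derivable (fun t : R => 1 + N * t ^+ 2) 0 1 by exact: ex_derive.
  apply: DeriveDef; first by apply: derivableV => //; exact: den.
  by rewrite deriveV ?den// derive_val scaler0.
have derZ (phi : R -> R) d (v : 'rV[R]_7) : is_derive (0 : R) (1 : R) phi d ->
    is_derive (0 : R) (1 : R) (fun t => phi t *: v) (d *: v).
  move=> dphi; have dp : differentiable phi 0 by apply/derivable1_diffP.
  have dpv : differentiable (fun t => phi t *: v) 0 by exact: differentiableZl.
  apply: DeriveDef; first exact/derivable1_diffP.
  by rewrite deriveE// diffZl//= -deriveE// derive_val.
have der_c : is_derive (0 : R) (1 : R) c X.
  have d1 : is_derive (0 : R) (1 : R) (fun t => b t * (1 - N * t ^+ 2)) 0.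
    apply: is_derive_eq; rewrite /GRing.scale /= /cst; lra.
  have d2 : is_derive (0 : R) (1 : R) (fun t => b t * t) 1.
    apply: is_derive_eq; rewrite /GRing.scale /= /cst b0; lra.
  have d3 := derZ _ _ x d1; have d4 := derZ _ _ X d2.
  by apply: is_derive_eq; rewrite scale0r scale1r add0r.
have dc : differentiable c 0 by apply/derivable1_diffP.
have [dY _] := tY _ Sx.
have dY0 : differentiable Y (c 0) by rewrite c0.
have dYc : differentiable (Y \o c) 0 by exact: differentiable_comp.
have eYc : 'D_1 (Y \o c) 0 = 'D_X Y x.
  have eX : 'd c 0 1 = X by rewrite -deriveE// derive_val.
  by rewrite deriveE// diff_comp//= eX c0 deriveE.
have : 'D_1 (fun t => dot ((Y \o c) t) (c t)) 0 = 0.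
  rewrite (_ : (fun t => _) = cst 0) ?derive_cst//.
  by apply/funext => t /=; have [] := tY _ (Sc t).
rewrite derive_dot; [|exact/derivable1_diffP..].
by rewrite eYc derive_val /= c0 => /eqP; rewrite addr_eq0 => /eqP.
Qed.

Lemma nablaS_tangent Y x v : sphere6 x -> dot (nablaS id Y x v) x = 0.
Proof. by move=> Sx; rewrite /nablaS dotBl dotZl Sx mulr1 subrr. Qed.

Lemma nablaS_metric X Y Z x : tangent_field Y -> tangent_field Z -> sphere6 x ->
  'D_X (fun z => dot (Y z) (Z z)) x =
  dot (nablaS id Y x X) (Z x) + dot (Y x) (nablaS id Z x X).
Proof.
move=> tY tZ Sx; have [dY Yx] := tY _ Sx; have [dZ Zx] := tZ _ Sx.
rewrite derive_dot; [|exact: diff_derivable..].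
rewrite /nablaS dotBl dotZl (dotC (Y x) (_ - _)) dotBl dotZl /=.
by rewrite !(dotC x) Yx Zx !mulr0 !subr0 (dotC (Y x)).
Qed.

Lemma nablaS_torsion_free (X Y : 'rV[R]_7 -> 'rV[R]_7) x :
  tangent_field X -> tangent_field Y -> sphere6 x ->
  nablaS id Y x (X x) - nablaS id X x (Y x) = 'D_(X x) Y x - 'D_(Y x) X x.
Proof.
move=> tX tY Sx; have [_ Xx] := tX _ Sx; have [_ Yx] := tY _ Sx.
by rewrite /nablaS /= !derive_tangent_field// (dotC (X x)) opprB subrKA.
Qed.

End SphereConnection.

Section LagrangianImmersion.
Variables (R : realType) (M : topologicalType) (MS : manifold3 R M).
Variable F : M -> 'rV[R]_7.

Definition local_rep (c : chart R M) : 'rV[R]_3 -> 'rV[R]_7 :=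
  F \o chart_inv c.

Definition immersion_in_S6 : Prop :=
  [/\ forall p, sphere6 (F p),
      forall c, atlas MS c -> smooth_on (chart_img c) (local_rep c) &
      forall c, atlas MS c -> forall x, chart_img c x ->
        injective ('d (local_rep c) x)].

(* J (T M) = T^perp M, where T^perp M is the orthogonal complement of T M in
   the tangent space of the sphere. *)
Definition lagrangian : Prop :=
  immersion_in_S6 /\
  forall c, atlas MS c -> forall x, chart_img c x ->
    let f := local_rep c in
    [set acs (f x) ('d f x v) | v in [set: 'rV[R]_3]] =
    [set w | dot w (f x) = 0 /\ forall v, dot w ('d f x v) = 0].

End LagrangianImmersion.

Section LeviCivita.
Variable R : realType.
Local Notation E := 'rV[R]_3.

(* nabla is the Levi-Civita connection of the metric g on the open set U. *)
Record levi_civita (U : set E) (g : E -> E -> E -> R)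
    (nabla : (E -> E) -> (E -> E) -> E -> E) : Prop := LeviCivita {
  lc_smooth : forall X Y, smooth_on U X -> smooth_on U Y ->
    smooth_on U (nabla X Y);
  lc_addl : forall X X' Y, smooth_on U X -> smooth_on U X' -> smooth_on U Y ->
    forall x, U x ->
      nabla (fun z => X z + X' z) Y x = nabla X Y x + nabla X' Y x;
  lc_scalel : forall (phi : E -> R) X Y,
    smooth_on U phi -> smooth_on U X -> smooth_on U Y ->
    forall x, U x -> nabla (fun z => phi z *: X z) Y x = phi x *: nabla X Y x;
  lc_addr : forall X Y Y', smooth_on U X -> smooth_on U Y -> smooth_on U Y' ->
    forall x, U x ->
      nabla X (fun z => Y z + Y' z) x = nabla X Y x + nabla X Y' x;
  lc_leibniz : forall (phi : E -> R) X Y,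
    smooth_on U phi -> smooth_on U X -> smooth_on U Y ->
    forall x, U x -> nabla X (fun z => phi z *: Y z) x =
      'D_(X x) phi x *: Y x + phi x *: nabla X Y x;
  lc_metric : forall X Y Z, smooth_on U X -> smooth_on U Y -> smooth_on U Z ->
    forall x, U x -> 'D_(X x) (fun z => g z (Y z) (Z z)) x =
      g x (nabla X Y x) (Z x) + g x (Y x) (nabla X Z x);
  lc_torsion_free : forall X Y, smooth_on U X -> smooth_on U Y ->
    forall x, U x ->
      nabla X Y x - nabla Y X x = 'D_(X x) Y x - 'D_(Y x) X x }.

End LeviCivita.

(* In all that follows f is an immersion into the sphere written in a chart,
   tangent vectors of M are given by their components in the chart, and e is a
   frame, orthonormal for the induced metric. *)
Section LocalGeometry.
Variable R : realType.
Local Notation E := 'rV[R]_3.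
Variable f : E -> 'rV[R]_7.

Definition induced_metric (x u v : E) : R := dot ('d f x u) ('d f x v).

Definition push (X : E -> E) (x : E) : 'rV[R]_7 := 'd f x (X x).

Definition Jpush (X : E -> E) (x : E) : 'rV[R]_7 := acs (f x) (push X x).

Definition omega (x u v w : E) : R :=
  dot (Gtensor (f x) ('d f x u) ('d f x v)) (acs (f x) ('d f x w)).

(* The orientation is the one for which omega is a positive volume form. *)
Definition oriented_orthonormal_frame (U : set E) (e : 'I_3 -> E -> E) : Prop :=
  [/\ forall i, smooth_on U (e i),
      forall x, U x -> forall i j,
        induced_metric x (e i x) (e j x) = (i == j)%:R &
      forall x, U x ->
        0 < omega x (e (inord 0) x) (e (inord 1) x) (e (inord 2) x)].

Variable nabla : (E -> E) -> (E -> E) -> E -> E.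

Definition sff (X Y : E -> E) (x : E) : 'rV[R]_7 :=
  nablaS f (push Y) x (X x) - 'd f x (nabla X Y x).

Variable e : 'I_3 -> E -> E.

(* The components of the shape operator A_xi X in the orthonormal frame e, from
   <A_xi X, Y> = <h(X, Y), xi>. *)
Definition shape (xi : E -> 'rV[R]_7) (X : E -> E) (x : E) : E :=
  \sum_i dot (sff X (e i) x) (xi x) *: e i x.

(* The part of the connection of the sphere that is normal to M. *)
Definition nabla_perp (X : E -> E) (xi : E -> 'rV[R]_7) (x : E) : 'rV[R]_7 :=
  let w := nablaS f xi x (X x) in
  w - \sum_i dot w (push (e i) x) *: push (e i) x.

Definition nabla_sff (X Y Z : E -> E) (x : E) : 'rV[R]_7 :=
  nabla_perp X (sff Y Z) x - sff (nabla X Y) Z x - sff Y (nabla X Z) x.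

Definition Ttensor (X Y Z : E -> E) (x : E) : 'rV[R]_7 :=
  let G A B := Gtensor (f x) (push A x) (push B x) in
  nabla_sff X Y Z x
  - 4^-1 *: (G X (shape (Jpush Z) Y) + G Y (shape (Jpush X) Z)
             + G Z (shape (Jpush Y) X)).

Definition omegac (i j k : 'I_3) (x : E) : R :=
  omega x (e i x) (e j x) (e k x).

Definition hc (i j k : 'I_3) (x : E) : R :=
  dot (sff (e i) (e j) x) (Jpush (e k) x).

Definition Tc (l i j k : 'I_3) (x : E) : R :=
  dot (Ttensor (e l) (e i) (e j) x) (Jpush (e k) x).

(* The symmetric 2-tensor with components sum_(a, b) h_abi h_abj. *)
Definition Stensor (Y Z : E -> E) (x : E) : R :=
  \sum_a \sum_b dot (sff (e a) (e b) x) (Jpush Y x)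
              * dot (sff (e a) (e b) x) (Jpush Z x).

Definition nabla_S (X Y Z : E -> E) (x : E) : R :=
  'D_(X x) (Stensor Y Z) x - Stensor (nabla X Y) Z x - Stensor Y (nabla X Z) x.

Definition Sc (i j : 'I_3) (x : E) : R := \sum_a \sum_b hc a b i x * hc a b j x.

Definition Smx (x : E) : 'M[R]_3 := \matrix_(i, j) Sc i j x.

Definition s_ (x : E) : R := \tr (Smx x).

Definition q_ (x : E) : R := \tr (Smx x *m Smx x).

(* dSc i j k is S_ij,k. *)
Definition dSc (i j k : 'I_3) (x : E) : R := nabla_S (e k) (e i) (e j) x.

Definition Pc (i j k : 'I_3) (x : E) : R :=
  \sum_a \sum_b hc a b i x * Tc a b j k x.

Definition Wc (i j : 'I_3) (x : E) : R :=
  \sum_a \sum_b omegac i a b x * Pc a b j x.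

Definition Ac (i j : 'I_3) (x : E) : R := 2^-1 * (Wc i j x + Wc j i x).

Definition Dc (i j k : 'I_3) (x : E) : R :=
  4^-1 * \sum_m (omegac k i m x * Sc m j x + omegac k j m x * Sc i m x).

End LocalGeometry.

(* Main.v *)
Require Import Defs.
From HB Require Import structures.
From mathcomp Require Import all_boot all_order all_algebra.
From mathcomp Require Import all_classical all_reals all_analysis.
From mathcomp Require Import ring lra.

Set Implicit Arguments.
Unset Strict Implicit.
Unset Printing Implicit Defensive.

Import Order.TTheory GRing.Theory Num.Theory.
Import numFieldNormedType.Exports.

Local Open Scope classical_set_scope.
Local Open Scope ring_scope.

(* The vectors f, E_i = df (e_i), J E_i form an orthonormal frame of R^7 along
   M, and G(X, Y) is the part of the cross product X x Y tangent to the
   sphere.  Differentiating <E_j, J E_k> = 0 shows that <E_1 x E_2, E_3> = 0 and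
   that h_ijk is totally symmetric; differentiating <E_1 x E_2, E_3> = 0 then
   shows that h is trace free.  The Codazzi equation is the J E_l component of
   the commutation of second derivatives of the E_j.  Together with an algebraic
   identity for symmetric trace-free 3-tensors in dimension three it makes T
   totally symmetric, and the expression of S_ij,k follows from the product rule
   for S.  The sum over S_ij,k S_ik,j is then a polynomial identity which uses
   nothing but P_ijk = P_ikj and the symmetry of S. *)

(** * The cross product of imaginary Cayley numbers *)

(** The obstacle is that J is not parallel, so h has two derivatives with complementary symmetries.
    The covariant derivative [covh] of the 3-tensor h_ijk is symmetric in its last three indices.
    The normal-valued derivative, [dsff], differs from it by sum_m h_abm omega_kmi and, by Codazzi,
    is symmetric in its first three. That difference, like each summand of the correction in T, is
    skew in two free indices and dies under total symmetrization; hence T is the total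
    symmetrization of either derivative. In S_ij,k the part T of [covh] yields the two P terms and
    the rest yields D.

    The connection [nabla] is known only through its axioms. The coefficients [Gam], [hcoef] and
    [omcoef] are therefore read off from flat derivatives in R^7, where mixed derivatives commute,
    and [nabla] is matched with them afterwards. The curvature of the sphere never has to be
    computed. *)

Lemma ord7_ind (P : 'I_7 -> Prop) :
  P (inord 0) -> P (inord 1) -> P (inord 2) -> P (inord 3) -> P (inord 4) ->
  P (inord 5) -> P (inord 6) -> forall i, P i.
Proof.
move=> P0 P1 P2 P3 P4 P5 P6 i; rewrite -(inord_val i).
by case: i => [[|[|[|[|[|[|[|//]]]]]]] ?].
Qed.

Lemma sum7E (R : nmodType) (F : 'I_7 -> R) :
  \sum_i F i = F (inord 0) + (F (inord 1) + (F (inord 2) + (F (inord 3) +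
   (F (inord 4) + (F (inord 5) + F (inord 6)))))).
Proof.
rewrite !big_ord_recl big_ord0 addr0.
by do !congr (_ + _); congr (F _); apply/val_inj; rewrite /= inordK.
Qed.

Section CrossAlgebra.
Variable R : realType.
Implicit Types x y z w : 'rV[R]_7.

(** The structure constants of the Cayley-Dickson basis: the oriented lines of the Fano plane are
    012, 034, 065, 135, 146, 236 and 254, and each coordinate collects the three lines through its
    index. *)
Definition cross_coord x y (k : nat) : R :=
  let a i := x 0 (inord i) in let b i := y 0 (inord i) in
  let m i j := a i * b j - a j * b i in
  nth 0 [:: m 1 2 + m 3 4 + m 6 5; m 2 0 + m 3 5 + m 4 6;
     m 0 1 + m 3 6 + m 5 4; m 4 0 + m 5 1 + m 6 2; m 0 3 + m 2 5 + m 6 1;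
     m 0 6 + m 1 3 + m 4 2; m 5 0 + m 1 4 + m 2 3] k.

Lemma crossE x y : cross x y = \row_i cross_coord x y i.
Proof.
apply/rowP; apply: ord7_ind; rewrite !mxE inordK //= /cross_coord/=.
all: rewrite /oct_of_im.
all: have eo k (lt : (k < 7)%N) : Ordinal lt = inord k :> 'I_7 by
  apply/val_inj; rewrite /= inordK.
all: rewrite !eo /=.
all: by field.
Qed.

Ltac gen_coords x :=
  move: (x 0 (inord 0)) (x 0 (inord 1)) (x 0 (inord 2)) (x 0 (inord 3))
    (x 0 (inord 4)) (x 0 (inord 5)) (x 0 (inord 6)) => ? ? ? ? ? ? ?.

(* The coordinates are generalized because [ring] is very slow at comparing
   atoms that contain [inord]. *)
Ltac cross_ring x y z :=
  rewrite ?crossE /dot ?sum7E; do ?rewrite !mxE !inordK //=;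
  rewrite /cross_coord /=; do ?rewrite !mxE ?inordK //= /cross_coord /=;
  gen_coords x; gen_coords y; gen_coords z; ring.

Lemma crossC x y : cross x y = - cross y x.
Proof. by apply/rowP; apply: ord7_ind; cross_ring x y y. Qed.

Lemma crossDr x y z : cross x (y + z) = cross x y + cross x z.
Proof. by apply/rowP; apply: ord7_ind; cross_ring x y z. Qed.

Lemma crossZr a x y : cross x (a *: y) = a *: cross x y.
Proof. by apply/rowP; apply: ord7_ind; cross_ring x y y. Qed.

Lemma crossNr x y : cross x (- y) = - cross x y.
Proof. by have := crossZr (- 1) x y; rewrite !scaleN1r. Qed.

Lemma crossDl x y z : cross (x + y) z = cross x z + cross y z.
Proof. by rewrite crossC crossDr opprD -!crossC. Qed.

Lemma crossZl a x y : cross (a *: x) y = a *: cross x y.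
Proof. by rewrite crossC crossZr -scalerN -crossC. Qed.

Lemma cross0r x : cross x 0 = 0.
Proof. by have := crossZr 0 x 0; rewrite !scale0r. Qed.

Lemma crossxx x : cross x x = 0.
Proof. by apply/rowP; apply: ord7_ind; cross_ring x x x. Qed.

Lemma cross_sumr n x (F : 'I_n -> 'rV[R]_7) :
  cross x (\sum_i F i) = \sum_i cross x (F i).
Proof. exact: (big_morph _ (crossDr x) (cross0r x)). Qed.

Lemma cross_suml n x (F : 'I_n -> 'rV[R]_7) :
  cross (\sum_i F i) x = \sum_i cross (F i) x.
Proof.
rewrite crossC cross_sumr -sumrN; apply: eq_bigr => i _; exact/esym/crossC.
Qed.

Lemma dot_cross_cycle x y z : dot (cross x y) z = dot x (cross y z).
Proof. by cross_ring x y z. Qed.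

Lemma cross_cross x y : cross x (cross x y) = dot x y *: x - dot x x *: y.
Proof. by apply/rowP; apply: ord7_ind; cross_ring x y y. Qed.

Lemma dotDr x y z : dot x (y + z) = dot x y + dot x z.
Proof. by rewrite dotC dotDl !(dotC x). Qed.

Lemma dotZr a x y : dot x (a *: y) = a * dot x y.
Proof. by rewrite dotC dotZl dotC. Qed.

Lemma dotNl x y : dot (- x) y = - dot x y.
Proof. by rewrite -scaleN1r dotZl mulN1r. Qed.

Lemma dotNr x y : dot x (- y) = - dot x y.
Proof. by rewrite dotC dotNl dotC. Qed.

Lemma dotBr x y z : dot x (y - z) = dot x y - dot x z.
Proof. by rewrite dotDr dotNr. Qed.

Lemma dot0l x : dot 0 x = 0.
Proof. by have := dotZl 0 0 x; rewrite scale0r mul0r. Qed.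

Lemma dot_suml n (F : 'I_n -> 'rV[R]_7) x :
  dot (\sum_i F i) x = \sum_i dot (F i) x.
Proof.
by elim/big_rec2 : _ => [|i a b _ <-]; rewrite ?dot0l ?dotDl.
Qed.

Lemma dot_sumr n (F : 'I_n -> 'rV[R]_7) x :
  dot x (\sum_i F i) = \sum_i dot x (F i).
Proof. by rewrite dotC dot_suml; apply: eq_bigr => i _; rewrite dotC. Qed.

(** Polarization of [cross_cross]. In dimension seven a single double product x * (y * z) has no
    such expansion, but its part symmetric in x and y does. *)
Lemma cross_cross_polar x y z : cross x (cross y z) + cross y (cross x z) =
  dot x z *: y + dot y z *: x - (2 * dot x y) *: z.
Proof.
have := cross_cross (x + y) z; rewrite !(crossDl, crossDr, dotDl, dotDr).
rewrite (cross_cross x) (cross_cross y) (dotC y x).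
move: (cross x (cross y z)) (cross y (cross x z)) => u v.
move: (dot x z) (dot y z) (dot x x) (dot x y) (dot y y) => a b c d e H.
apply/rowP => i; move/rowP: H => /(_ i); rewrite !mxE; lra.
Qed.

Lemma dot_cross_cross x y z :
  dot (cross x y) (cross x z) = dot x x * dot y z - dot x y * dot x z.
Proof.
rewrite (crossC x y) dotNl dot_cross_cycle cross_cross dotBr !dotZr (dotC y x).
ring.
Qed.

(** Orthonormality says B B^T = 1; since B is square, also B^T B = 1, which is completeness. *)
Lemma orthonormal_expansion (b : 'I_7 -> 'rV[R]_7) w :
  (forall i j, dot (b i) (b j) = (i == j)%:R) -> w = \sum_i dot w (b i) *: b i.
Proof.
move=> ob; pose B : 'M[R]_7 := \matrix_i b i.
have BBt : B *m B^T = 1%:M.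
  apply/matrixP => i j; rewrite !mxE -ob.
  by apply: eq_bigr => k _; rewrite !mxE.
rewrite -[LHS]mulmx1 -(mulmx1C BBt) mulmxA mulmx_sum_row.
apply: eq_bigr => i _; rewrite rowK; congr (_ *: _).
by rewrite !mxE; apply: eq_bigr => k _; rewrite !mxE.
Qed.

End CrossAlgebra.

(** * Directional derivatives and smooth maps *)

Section DirectionalDerivatives.
Variables (R : realType) (V : normedModType R).

Lemma is_derive_mx m n (Y : V -> 'M[R]_(m, n)) (x v : V) (d : 'M[R]_(m, n)) :
  (forall i j, is_derive x v (fun t => Y t i j) (d i j)) <-> is_derive x v Y d.
Proof.
split=> [dY|[dY <-] i j].
  have dY' : derivable Y x v.
    by apply: (derivable_mxP Y x v).2 => i j; exact: ex_derive.
  apply: DeriveDef => //; rewrite derive_mx//; apply/matrixP => i j.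
  by rewrite mxE derive_val.
apply: DeriveDef; first exact: (derivable_mxP Y x v).1.
by rewrite derive_mx// mxE.
Qed.

Lemma is_derive_fsum (W : normedModType R) n (Y : 'I_n -> V -> W) (x v : V)
    (d : 'I_n -> W) : (forall i, is_derive x v (Y i) (d i)) ->
  is_derive x v (fun t => \sum_i Y i t) (\sum_i d i).
Proof.
move=> dY; rewrite (_ : (fun t => _) = \sum_i Y i); first exact: is_derive_sum.
by apply/funext => t; rewrite fct_sumE.
Qed.

Lemma is_derive_prod (f g : V -> R) (x v : V) (df dg : R) :
  is_derive x v f df -> is_derive x v g dg ->
  is_derive x v (fun t => f t * g t) (df * g x + f x * dg).
Proof.
move=> hf hg; have := is_deriveM hf hg => h.
by apply: is_derive_eq; rewrite addrC /GRing.scale /= (mulrC df).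
Qed.

Lemma is_derive_scale m n (f : V -> R) (Y : V -> 'M[R]_(m, n)) (x v : V)
    (df : R) (dY : 'M[R]_(m, n)) :
  is_derive x v f df -> is_derive x v Y dY ->
  is_derive x v (fun t => f t *: Y t) (df *: Y x + f x *: dY).
Proof.
move=> hf /is_derive_mx hY; apply/is_derive_mx => i j; rewrite !mxE.
rewrite (_ : (fun t => _) = fun t => f t * Y t i j).
  exact: is_derive_prod.
by apply/funext => t; rewrite mxE.
Qed.

Lemma is_derive_near (W : normedModType R) (U : set V) (f g : V -> W) (x v : V)
    (d : W) : open U -> U x -> (forall z, U z -> f z = g z) ->
  is_derive x v f d -> is_derive x v g d.
Proof.
move=> oU Ux fg; apply: near_eq_is_derive.
by near=> z; apply: fg; near: z; exact: open_nbhs_nbhs.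
Unshelve. all: by end_near. Qed.

Lemma derive_near (W : normedModType R) (U : set V) (f g : V -> W) (x v : V) :
  open U -> U x -> (forall z, U z -> f z = g z) -> 'D_v f x = 'D_v g x.
Proof.
move=> oU Ux fg; apply: near_eq_derive.
by near=> z; apply: fg; near: z; exact: open_nbhs_nbhs.
Unshelve. all: by end_near. Qed.

End DirectionalDerivatives.

(** * Closure properties of C^k maps *)

Section SmoothFunctions.
Variables (R : realType) (V : normedModType R).

Lemma differentiable_near (W : normedModType R) (U : set V) (f g : V -> W) x :
  open U -> U x -> (forall z, U z -> f z = g z) ->
  differentiable f x -> differentiable g x.
Proof.
move=> oU Ux fg df; have [cd /eqaddoP fE] := (diff_locallyP x f).1 df.
have gE : g \o shift x = cst (g x) + 'd f x +o_ 0 id.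
  apply/eqaddoP => eps eps0; have := fE _ eps0.
  have : \forall z \near (0 : V), U (z + x).
    have : \forall z \near x, U z by exact: open_nbhs_nbhs.
    by rewrite (near_shift 0) subr0.
  apply: filterS2 => z /fg; rewrite /= !fctE /= => <-; by rewrite (fg _ Ux).
have dgE := diff_unique cd gE.
by apply/(diff_locallyP x g).2; rewrite dgE; split.
Qed.

(** [Ck] iterates globally defined derivatives, while the sum and product rules compute these only
    at points of U. Each closure property below passes through this locality statement in its
    inductive step. *)
Lemma Ck_eq (W : normedModType R) k (U : set V) (f g : V -> W) : open U ->
  (forall z, U z -> f z = g z) -> Ck k U f -> Ck k U g.
Proof.
move=> oU; elim: k f g => [|k IH] f g fg /=.
  move=> cf x Ux; suff : g @ x --> g x by [].
  rewrite -(fg _ Ux); apply: cvg_trans (cf x Ux); apply: near_eq_cvg.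
  by near=> z; apply: fg; near: z; exact: open_nbhs_nbhs.
move=> [df cf]; split=> [x Ux|v].
  exact: (differentiable_near oU Ux fg (df x Ux)).
by apply: IH (cf v) => z Uz; exact: (derive_near v oU Uz fg).
Unshelve. all: by end_near. Qed.

Lemma CkW (W : normedModType R) k (U : set V) (f : V -> W) :
  Ck k.+1 U f -> Ck k U f.
Proof.
elim: k f => [|k IH] f [df cf].
  by move=> x Ux; apply: differentiable_continuous; exact: df.
by split => // v; exact: IH.
Qed.

Lemma Ck_sub (W : normedModType R) k (U U' : set V) (f : V -> W) :
  U' `<=` U -> Ck k U f -> Ck k U' f.
Proof.
move=> UU; elim: k f => [|k IH] f /=; first by move=> cf x /UU; exact: cf.
by move=> [df cf]; split=> [x /UU|v]; [exact: df|exact: IH].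
Qed.

Lemma Ck_cst (W : normedModType R) k (U : set V) (a : W) : Ck k U (cst a).
Proof.
elim: k a => [|k IH] a /=; first by move=> x _; exact: cst_continuous.
split=> [x _|v]; first exact: differentiable_cst.
by rewrite (_ : 'D_v _ = cst 0)//; apply/funext => x; rewrite derive_cst.
Qed.

Lemma CkD (W : normedModType R) k (U : set V) (f g : V -> W) : open U ->
  Ck k U f -> Ck k U g -> Ck k U (f + g).
Proof.
move=> oU; elim: k f g => [|k IH] f g /=.
  by move=> cf cg x Ux; apply: continuousD; [exact: cf|exact: cg].
move=> [df cf] [dg cg]; split=> [x Ux|v].
  by apply: differentiableD; [exact: df|exact: dg].
apply: (Ck_eq oU _ (IH _ _ (cf v) (cg v))) => z Uz.
by rewrite deriveD//; apply: diff_derivable; [exact: df|exact: dg].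
Qed.

Lemma CkM k (U : set V) (f g : V -> R) : open U ->
  Ck k U f -> Ck k U g -> Ck k U (f * g).
Proof.
move=> oU; elim: k f g => [|k IH] f g.
  by move=> cf cg x Ux; apply: continuousM; [exact: cf|exact: cg].
move=> Cf Cg; have [df cf] := Cf; have [dg cg] := Cg; split=> [x Ux|v].
  by apply: differentiableM; [exact: df|exact: dg].
(* The product rule pairs an undifferentiated factor with a derivative, so that factor is lowered to
   order k. *)
have := CkD oU (IH _ _ (CkW Cf) (cg v)) (IH _ _ (CkW Cg) (cf v)).
apply: Ck_eq => // z Uz.
by rewrite deriveM//; apply: diff_derivable; [exact: df|exact: dg].
Qed.

Lemma Ck_sum (W : normedModType R) k n (U : set V) (F : 'I_n -> V -> W) :
  open U -> (forall i, Ck k U (F i)) -> Ck k U (\sum_i F i).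
Proof.
move=> oU CF; elim/big_ind : _ => //; first exact: (Ck_cst k U 0).
by move=> ? ?; exact: CkD.
Qed.

Lemma Ck_coord k m n (U : set V) (Y : V -> 'M[R]_(m, n)) i j : open U ->
  Ck k U Y -> Ck k U (fun z => Y z i j).
Proof.
move=> oU; elim: k Y => [|k IH] Y.
  move=> cY x Ux.
  apply: (@continuous_comp _ _ _ Y (fun A : 'M[R]_(m, n) => A i j)).
    exact: cY.
  exact: coord_continuous.
move=> [dY cY]; split=> [x Ux|v].
  apply: (@differentiable_comp _ _ _ _ Y (fun A : 'M[R]_(m, n) => A i j)).
    exact: dY.
  exact: differentiable_coord.
apply: (Ck_eq oU _ (IH _ (cY v))) => z Uz.
by rewrite derive_mx ?mxE//; apply: diff_derivable; exact: dY.
Qed.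

Lemma CkZl (W : normedModType R) k (U : set V) (f : V -> R) (w : W) : open U ->
  Ck k U f -> Ck k U (fun z => f z *: w).
Proof.
move=> oU; elim: k f => [|k IH] f.
  move=> cf x Ux; apply: (@continuous_comp _ _ _ f (fun a : R => a *: w)).
    exact: cf.
  exact: scalel_continuous.
move=> [df cf]; split=> [x Ux|v].
  by apply: differentiableZl; exact: df.
apply: (Ck_eq oU _ (IH _ (cf v))) => z Uz.
have dz := df z Uz.
by rewrite [RHS]deriveE ?diffZl//= ?deriveE//; exact: differentiableZl.
Qed.

Lemma Ck_mx k m n (U : set V) (Y : V -> 'M[R]_(m, n)) : open U ->
  (forall i j, Ck k U (fun z => Y z i j)) -> Ck k U Y.
Proof.
move=> oU cY.
(* Scalar functions times constant matrices, so that [CkZl] suffices. *)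
have -> : Y = \sum_i \sum_j (fun z => Y z i j *: delta_mx i j).
  apply/funext => z; rewrite {1}[Y z]matrix_sum_delta fct_sumE.
  by apply: eq_bigr => i _; rewrite fct_sumE.
by apply: Ck_sum => // i; apply: Ck_sum => // j; exact: CkZl.
Qed.

Lemma CkZ k m n (U : set V) (f : V -> R) (Y : V -> 'M[R]_(m, n)) : open U ->
  Ck k U f -> Ck k U Y -> Ck k U (fun z => f z *: Y z).
Proof.
move=> oU cf cY; apply: Ck_mx => // i j.
have := CkM oU cf (Ck_coord i j oU cY).
by apply: Ck_eq => // z _; rewrite mxE.
Qed.

End SmoothFunctions.

(** * Symmetry of second derivatives *)

Section SecondDerivatives.
Variables (R : realType) (V : normedModType R).

Lemma is_derive_line (g : V -> R) (y u : V) (s : R) :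
  differentiable g (y + s *: u) ->
  is_derive s (1 : R) (fun a => g (y + a *: u)) ('D_u g (y + s *: u)).
Proof.
move=> dg; pose c (a : R) : V := y + a *: u.
have did : differentiable (id : R -> R) s by [].
have dz : differentiable (fun a : R => a *: u) s by exact: differentiableZl.
have dc : differentiable c s by apply: differentiableD.
have ec : 'd c s 1 = u.
  rewrite (_ : c = cst y + (fun a : R => a *: u))// diffD// diff_cst.
  by rewrite diffZl//= diff_val add0r scale1r.
have dgc : differentiable (g \o c) s by exact: differentiable_comp.
apply: DeriveDef; first exact: diff_derivable.
by rewrite (deriveE _ dgc) diff_comp//= ec deriveE.
Qed.

(** Two mean value theorems: one along u for [phi], the increment of g across t v, and one along v
    for the derivative of g in direction u. *)
Lemma second_difference (U : set V) (g : V -> R) (x u v : V) (t : R) : 0 < t ->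
  (forall a b, 0 <= a <= t -> 0 <= b <= t -> U (x + a *: u + b *: v)) ->
  Ck 2 U g ->
  exists a b, [/\ 0 <= a <= t, 0 <= b <= t &
    g (x + t *: u + t *: v) - g (x + t *: u) - g (x + t *: v) + g x =
    'D_v ('D_u g) (x + a *: u + b *: v) * t * t].
Proof.
move=> t0 hU [dg cg]; have [dug _] := cg u.
have in0t a : a \in `]0, t[%R -> 0 <= a <= t.
  by rewrite in_itv/= => /andP[? ?]; rewrite !ltW.
have t00 : (0 : R) <= 0 <= t by apply/andP; split => //; exact: ltW.
have tt : 0 <= t <= t by apply/andP; split => //; exact: ltW.
have hU0 a : 0 <= a <= t -> U (x + a *: u).
  by move=> ha; have := hU a 0 ha t00; rewrite scale0r addr0.
pose phi (s : R) := g (x + t *: v + s *: u) - g (x + s *: u).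
have dphi s : 0 <= s <= t ->
    is_derive s 1 phi ('D_u g (x + s *: u + t *: v) - 'D_u g (x + s *: u)).
  move=> hs; rewrite addrAC.
  have h1 : is_derive s (1 : R) (fun a => g (x + t *: v + a *: u))
      ('D_u g (x + t *: v + s *: u)).
    by apply: is_derive_line; apply: dg; rewrite addrAC; exact: hU.
  have h2 : is_derive s (1 : R) (fun a => g (x + a *: u)) ('D_u g (x + s *: u)).
    by apply: is_derive_line; apply: dg; exact: hU0.
  exact: is_deriveB.
have [|a /in0t ha Ea] := MVT t0 (fun s hs => dphi s (in0t s hs)).
  apply: derivable_within_continuous => s; rewrite in_itv/= => hs.
  by have := dphi s hs => ?; exact: ex_derive.
have dpsi s : 0 <= s <= t -> is_derive s (1 : R)
    (fun b => 'D_u g (x + a *: u + b *: v))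
    ('D_v ('D_u g) (x + a *: u + s *: v)).
  by move=> hs; apply: is_derive_line; apply: dug; exact: hU.
have [|b /in0t hb Eb] := MVT t0 (fun s hs => dpsi s (in0t s hs)).
  apply: derivable_within_continuous => s; rewrite in_itv/= => hs.
  by have := dpsi s hs => ?; exact: ex_derive.
exists a, b; split => //.
move: Eb; rewrite subr0 scale0r addr0 => <-; rewrite subr0 in Ea.
rewrite -Ea /phi !scale0r !addr0 (addrAC x (t *: v)); ring.
Qed.

(** The second difference is symmetric in u and v, so both mixed derivatives take a common value at
    two points close to x; their continuity at x concludes. *)
Lemma derive_comm (U : set V) (g : V -> R) (x u v : V) : open U -> U x ->
  Ck 2 U g -> 'D_u ('D_v g) x = 'D_v ('D_u g) x.
Proof.
move=> oU Ux Cg; have [dg cg] := Cg; have [_ /(_ v) cuv] := cg u.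
have [_ /(_ u) cvu] := cg v.
apply/eqP; rewrite -subr_eq0 -normr_le0; apply/ler_addgt0Pr => eps eps0.
rewrite add0r.
have e2 : 0 < eps / 2 by rewrite divr_gt0.
have := open_nbhs_nbhs (conj oU Ux).
have /cvgrPdist_lt/(_ _ e2) := cvu x Ux.
have /cvgrPdist_lt/(_ _ e2) := cuv x Ux.
move=> n1 n2 n3.
have [r /= r0 br] := (nbhs_ballP _ _).1 (filterI n3 (filterI n1 n2)).
(* Small enough for the parallelogram on t u and t v to stay in the ball; the 1 covers u = v = 0. *)
pose t := r / (`|u| + `|v| + 1).
have den0 : 0 < `|u| + `|v| + 1 by rewrite ltr_pwDr// addr_ge0.
have t0 : 0 < t by rewrite divr_gt0.
have in_ball a b : 0 <= a <= t -> 0 <= b <= t ->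
    ball x r (x + a *: u + b *: v).
  move=> /andP[a0 at_] /andP[b0 bt].
  rewrite -ball_normE /= -addrA opprD addNKr normrN.
  apply: (le_lt_trans (ler_normD _ _)); rewrite !normrZ !ger0_norm//.
  have : t * (`|u| + `|v| + 1) = r by rewrite divfK// gt_eqF.
  have : a * `|u| <= t * `|u| by rewrite ler_wpM2r.
  have : b * `|v| <= t * `|v| by rewrite ler_wpM2r.
  nra.
have [|a [b [ha hb E1]]] :=
    second_difference t0 _ Cg (x := x) (u := u) (v := v).
  by move=> a b ha hb; have [] := br _ (in_ball _ _ ha hb).
have [|b' [a' [hb' ha' E2]]] :=
    second_difference t0 _ Cg (x := x) (u := v) (v := u).
  move=> b' a' hb' ha'; rewrite addrAC.
  by have [] := br _ (in_ball _ _ ha' hb').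
have [_ [/= h1 _]] := br _ (in_ball _ _ ha hb).
have [_ [/= _ h2]] := br _ (in_ball _ _ ha' hb').
have E : 'D_v ('D_u g) (x + a *: u + b *: v) =
         'D_u ('D_v g) (x + a' *: u + b' *: v).
  have t_neq0 : t != 0 by rewrite gt_eqF.
  suff E12 : 'D_v ('D_u g) (x + a *: u + b *: v) * t * t =
      'D_u ('D_v g) (x + a' *: u + b' *: v) * t * t.
    exact: (mulIf t_neq0 (mulIf t_neq0 E12)).
  apply: etrans (esym E1) _.
  by move: E2; rewrite (addrAC x (t *: v)) (addrAC x (b' *: v)) => <-; ring.
rewrite E in h1.
move: h1 h2; set K := 'D_u ('D_v g) (_ + _ + _).
move: ('D_u ('D_v g) x) ('D_v ('D_u g) x) K => L L' K h1 h2.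
rewrite -(subrKA K) (splitr eps); apply: (le_trans (ler_normD _ _)).
by apply: lerD; apply: ltW; [exact: h2|rewrite distrC; exact: h1].
Qed.

End SecondDerivatives.

(** * Derivatives along smooth vector fields and their commutator *)

Section VectorFields.
Variables (R : realType) (n m : nat).
Local Notation V := 'rV[R]_n.
Implicit Types (U : set V) (X Z : V -> V) (Y : V -> 'rV[R]_m).

Lemma derive_coordE Y x v : differentiable Y x ->
  'D_v Y x = \sum_i v 0 i *: 'D_(delta_mx 0 i) Y x.
Proof.
move=> dY; rewrite deriveE// {1}[v]row_sum_delta linear_sum.
by apply: eq_bigr => i _; rewrite linearZ deriveE.
Qed.

Lemma smooth_diff (W : normedModType R) U (Y : V -> W) x :
  smooth_on U Y -> U x -> differentiable Y x.
Proof. by move=> /(_ 1)[dY _]; exact: dY. Qed.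

Lemma smooth_derivable (W : normedModType R) U (Y : V -> W) x v :
  smooth_on U Y -> U x -> derivable Y x v.
Proof. by move=> sY Ux; apply: diff_derivable; exact: smooth_diff sY Ux. Qed.

Lemma smooth_is_derive (W : normedModType R) U (Y : V -> W) x v :
  smooth_on U Y -> U x -> is_derive x v Y ('D_v Y x).
Proof. by move=> sY Ux; apply: derivableP; exact: smooth_derivable sY Ux. Qed.

Lemma smooth_derive_cst (W : normedModType R) U (Y : V -> W) v :
  smooth_on U Y -> smooth_on U ('D_v Y).
Proof. by move=> sY k; have [_] := sY k.+1; exact. Qed.

Lemma smooth_sub (W : normedModType R) U U' (Y : V -> W) : U' `<=` U ->
  smooth_on U Y -> smooth_on U' Y.
Proof. by move=> UU sY k; exact: Ck_sub (sY k). Qed.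

Lemma smooth_eq (W : normedModType R) U (Y Y' : V -> W) : open U ->
  (forall z, U z -> Y z = Y' z) -> smooth_on U Y -> smooth_on U Y'.
Proof. by move=> oU YY' sY k; apply: Ck_eq (sY k). Qed.

Lemma smooth_derive U X Y : open U -> smooth_on U X -> smooth_on U Y ->
  smooth_on U (fun z => 'D_(X z) Y z).
Proof.
move=> oU sX sY k.
(* Expanding X in coordinates reduces to derivatives in constant directions, the only ones that [Ck]
   controls. *)
apply: (@Ck_eq _ _ _ _ _
  (\sum_i (fun z => X z 0 i *: 'D_(delta_mx 0 i) Y z))) => //.
  by move=> z Uz; rewrite derive_coordE ?fct_sumE//; exact: smooth_diff sY Uz.
apply: Ck_sum => // i; apply: CkZ => //; first exact: Ck_coord.
exact: smooth_derive_cst.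
Qed.

Lemma derive_comm_row U Y x u v : open U -> U x -> smooth_on U Y ->
  'D_u ('D_v Y) x = 'D_v ('D_u Y) x.
Proof.
move=> oU Ux sY.
have E w w' j : ('D_w ('D_w' Y) x) 0 j = 'D_w ('D_w' (fun z => Y z 0 j)) x.
  rewrite derive_mx ?mxE; last first.
    exact: smooth_derivable (smooth_derive_cst _ sY) Ux.
  apply: (derive_near _ oU Ux) => z Uz.
  by rewrite derive_mx ?mxE//; exact: smooth_derivable sY Uz.
apply/rowP => j.
apply: etrans (E u v j) _.
apply: etrans _ (esym (E v u j)).
apply: (derive_comm u v oU Ux).
exact: Ck_coord.
Qed.

Lemma derive_derive U X Y x w : open U -> U x ->
  smooth_on U X -> smooth_on U Y ->
  'D_w (fun z => 'D_(X z) Y z) x = 'D_('D_w X x) Y x + 'D_(X x) ('D_w Y) x.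
Proof.
move=> oU Ux sX sY.
have E z : U z -> \sum_i X z 0 i *: 'D_(delta_mx 0 i) Y z = 'D_(X z) Y z.
  by move=> Uz; rewrite -derive_coordE//; exact: smooth_diff sY Uz.
have dXY : is_derive x w (fun z => \sum_i X z 0 i *: 'D_(delta_mx 0 i) Y z)
   (\sum_i (('D_w X x) 0 i *: 'D_(delta_mx 0 i) Y x
            + X x 0 i *: 'D_w ('D_(delta_mx 0 i) Y) x)).
  apply: is_derive_fsum => i; apply: is_derive_scale.
    by move: (smooth_is_derive w sX Ux) => /is_derive_mx.
  exact: smooth_is_derive (smooth_derive_cst _ sY) Ux.
have := is_derive_near oU Ux E dXY => dE.
rewrite derive_val big_split /= -derive_coordE; last exact: smooth_diff sY Ux.
congr (_ + _); rewrite [RHS]derive_coordE.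
  by apply: eq_bigr => i _; rewrite (derive_comm_row _ _ oU Ux sY).
exact: smooth_diff (smooth_derive_cst _ sY) Ux.
Qed.

(** The second-order terms cancel by symmetry, leaving the derivative along the Lie bracket. Applied
    to f it makes the second fundamental form symmetric; applied to the frame vectors it gives
    Codazzi. *)
Lemma derive_commutator U X Z Y x : open U -> U x ->
  smooth_on U X -> smooth_on U Z -> smooth_on U Y ->
  'D_(X x) (fun z => 'D_(Z z) Y z) x - 'D_(Z x) (fun z => 'D_(X z) Y z) x =
  'D_('D_(X x) Z x - 'D_(Z x) X x) Y x.
Proof.
move=> oU Ux sX sZ sY; have dY := smooth_diff sY Ux.
have eX := etrans (derive_derive (X x) oU Ux sZ sY)
  (congr1 (+%R _) (derive_comm_row (Z x) (X x) oU Ux sY)).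
have eZ := derive_derive (Z x) oU Ux sX sY.
have eB a b : 'D_(a - b) Y x = 'D_a Y x - 'D_b Y x.
  by rewrite !deriveE// linearB.
apply: etrans (congr2 (fun a b => a - b) eX eZ) _.
apply: etrans _ (esym (eB _ _)).
have cancel (a b c : 'rV[R]_m) : a + c - (b + c) = a - b.
  by rewrite opprD addrACA subrr addr0.
exact: cancel.
Qed.

End VectorFields.

(** * Product rules for the scalar and cross products *)

Section DeriveDotCross.
Variables (R : realType) (V : normedModType R).
Implicit Types Y Z : V -> 'rV[R]_7.

Lemma is_derive_dot Y Z (x v : V) dY dZ :
  is_derive x v Y dY -> is_derive x v Z dZ ->
  is_derive x v (fun t => dot (Y t) (Z t)) (dot dY (Z x) + dot (Y x) dZ).
Proof.
move=> /is_derive_mx hY /is_derive_mx hZ; rewrite /dot -big_split /=.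
by apply: is_derive_fsum => i; exact: is_derive_prod.
Qed.

Lemma cross_coordE (y z : 'rV[R]_7) : cross y z =
  \sum_i \sum_j (y 0 i * z 0 j) *: cross (delta_mx 0 i) (delta_mx 0 j).
Proof.
rewrite {1}[y]row_sum_delta cross_suml; apply: eq_bigr => i _.
rewrite {1}[z]row_sum_delta cross_sumr; apply: eq_bigr => j _.
by rewrite crossZr crossZl scalerA mulrC.
Qed.

Lemma is_derive_cross Y Z (x v : V) dY dZ :
  is_derive x v Y dY -> is_derive x v Z dZ ->
  is_derive x v (fun t => cross (Y t) (Z t)) (cross dY (Z x) + cross (Y x) dZ).
Proof.
move=> /is_derive_mx hY /is_derive_mx hZ.
rewrite (_ : (fun t => _) = fun t => \sum_i \sum_j
   (Y t 0 i * Z t 0 j) *: cross (delta_mx 0 i) (delta_mx 0 j)); last first.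
  by apply/funext => t; exact: cross_coordE.
rewrite !cross_coordE -big_split /=; apply: is_derive_fsum => i.
rewrite -big_split /=; apply: is_derive_fsum => j; rewrite -scalerDl.
rewrite -[X in is_derive _ _ _ X]addr0 -(scaler0 _ (Y x 0 i * Z x 0 j)).
by apply: is_derive_scale; exact: is_derive_prod.
Qed.

End DeriveDotCross.

(** * Tensors in dimension three *)

Section ThreeDimensionalTensors.
Variables (R : realFieldType) (i0 i1 i2 : 'I_3).
Hypothesis sum3 : forall F : 'I_3 -> R, \sum_i F i = F i0 + F i1 + F i2.
Hypothesis ind3 : forall P : 'I_3 -> Prop,
  P i0 -> P i1 -> P i2 -> forall i, P i.

Definition volume_tensor (w : 'I_3 -> 'I_3 -> 'I_3 -> R) :=
  [/\ forall i j k, w i j k = - w j i k, forall i j k, w i j k = w j k i &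
      w i0 i1 i2 = 1].

Lemma volume_tensorE w : volume_tensor w ->
  (w i0 i1 i2 = 1) * (w i1 i2 i0 = 1) * (w i2 i0 i1 = 1) *
  (w i1 i0 i2 = -1) * (w i0 i2 i1 = -1) * (w i2 i1 i0 = -1) *
  (forall i j, w i i j = 0) * (forall i j, w i j i = 0) *
  (forall i j, w j i i = 0).
Proof.
move=> [wN wC w1].
have w0 i j : w i i j = 0 by have := wN i i j; lra.
have w120 : w i1 i2 i0 = 1 by rewrite -wC.
have w201 : w i2 i0 i1 = 1 by rewrite -wC.
by do !split=> //; try (by rewrite wN ?w1 ?w120 ?w201);
  move=> i j; rewrite -?(wC i) // wC.
Qed.

Definition symmetric_traceless (h : 'I_3 -> 'I_3 -> 'I_3 -> R) :=
  [/\ forall i j k, h i j k = h j i k, forall i j k, h i j k = h i k j &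
      forall k, \sum_i h i i k = 0].

(** Rewriting with this table leaves seven free components, the dimension of the space of such
    tensors, so that the identities below become plain polynomial identities. *)
Lemma symmetric_tracelessE h : symmetric_traceless h ->
  (h i1 i0 i0 = h i0 i0 i1) * (h i0 i1 i0 = h i0 i0 i1) *
  (h i2 i0 i0 = h i0 i0 i2) * (h i0 i2 i0 = h i0 i0 i2) *
  (h i1 i0 i1 = h i0 i1 i1) * (h i1 i1 i0 = h i0 i1 i1) *
  (h i2 i1 i1 = h i1 i1 i2) * (h i1 i2 i1 = h i1 i1 i2) *
  (h i0 i2 i1 = h i0 i1 i2) * (h i1 i0 i2 = h i0 i1 i2) *
  (h i1 i2 i0 = h i0 i1 i2) * (h i2 i0 i1 = h i0 i1 i2) *
  (h i2 i1 i0 = h i0 i1 i2) *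
  (h i0 i2 i2 = - h i0 i0 i0 - h i0 i1 i1) *
  (h i2 i0 i2 = - h i0 i0 i0 - h i0 i1 i1) *
  (h i2 i2 i0 = - h i0 i0 i0 - h i0 i1 i1) *
  (h i1 i2 i2 = - h i0 i0 i1 - h i1 i1 i1) *
  (h i2 i1 i2 = - h i0 i0 i1 - h i1 i1 i1) *
  (h i2 i2 i1 = - h i0 i0 i1 - h i1 i1 i1) *
  (h i2 i2 i2 = - h i0 i0 i2 - h i1 i1 i2).
Proof.
move=> [h12 h23 h0].
move: (h0 i0) (h0 i1) (h0 i2); rewrite !sum3 => t0 t1 t2.
have e1 := h23 i1 i1 i0; have e2 := h12 i1 i0 i1.
have e3 := h23 i2 i2 i0; have e4 := h12 i2 i0 i2.
have e5 := h23 i2 i2 i1; have e6 := h12 i2 i1 i2.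
have e7 := h23 i0 i1 i0; have e8 := h12 i1 i0 i0.
have e9 := h23 i0 i2 i0; have e10 := h12 i2 i0 i0.
have e11 := h23 i1 i2 i1; have e12 := h12 i2 i1 i1.
have e13 := h23 i0 i2 i1; have e14 := h12 i1 i0 i2; have e15 := h12 i2 i0 i1.
have e16 := h23 i2 i1 i0; have e17 := h23 i1 i2 i0.
by do !split; lra.
Qed.

Section SecondFundamentalForm.
Variables (w h : 'I_3 -> 'I_3 -> 'I_3 -> R).
Hypotheses (hw : volume_tensor w) (hh : symmetric_traceless h).
Variable H : 'I_3 -> 'I_3 -> 'I_3 -> 'I_3 -> R.
Hypothesis H23 : forall k a b i, H k a b i = H k b a i.
Hypothesis H34 : forall k a b i, H k a b i = H k a i b.

(* [H] is the covariant derivative of the 3-tensor [h]; [dsff] is that of the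
   normal valued form, which also involves the derivative of [J]. *)
Definition dsff k a b i := H k a b i + \sum_m h a b m * w k m i.
Definition Tcorr k a b i :=
  4^-1 * \sum_m (w k m i * h a b m + w a m i * h b k m + w b m i * h a k m).
Definition Tfull k a b i := dsff k a b i - Tcorr k a b i.

(** Contract the part skew in (b, i) with the volume form, and write c for the factor of [Tcorr].
    The trace terms vanish and the products of volume forms leave (-(1 - c) + c + 2c) h_akl, where
    the 2 is 3 - 1 from the dimension. This is zero exactly for c = 1/4. *)
Lemma Tcorr_swap34 k a b i :
  \sum_m h a b m * w k m i - Tcorr k a b i =
  \sum_m h a i m * w k m b - Tcorr k a i b.
Proof.
rewrite /Tcorr !sum3.
have wE := volume_tensorE hw; have hE := symmetric_tracelessE hh.
move: k a b i; do 4![apply: ind3]; rewrite !wE ?hE; by field.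
Qed.

Hypothesis codazzi : forall k a b i, dsff k a b i = dsff a k b i.

Lemma Tfull_swap12 k a b i : Tfull k a b i = Tfull a k b i.
Proof.
rewrite /Tfull codazzi /Tcorr; congr (_ - _ * _); apply: eq_bigr => m _.
case: hh => h12 h23 _; rewrite (h12 k b) (h12 a b) (h12 k a); ring.
Qed.

Lemma Tfull_swap23 k a b i : Tfull k a b i = Tfull k b a i.
Proof.
case: hh => h12 h23 _; rewrite /Tfull /dsff H23; congr (_ + _ - _ * _).
  by apply: eq_bigr => m _; rewrite h12.
by apply: eq_bigr => m _; rewrite (h12 b a); ring.
Qed.

Lemma Tfull_swap34 k a b i : Tfull k a b i = Tfull k a i b.
Proof. by rewrite /Tfull /dsff -!addrA Tcorr_swap34 H34. Qed.

Let S i j := \sum_a \sum_b h a b i * h a b j.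
Let P i j k := \sum_a \sum_b h a b i * Tfull a b j k.
Let D i j k := 4^-1 * \sum_m (w k i m * S m j + w k j m * S i m).

Lemma P_swap23 i j k : P i j k = P i k j.
Proof.
by apply: eq_bigr => a _; apply: eq_bigr => b _; rewrite Tfull_swap34.
Qed.

(** This is the contribution to the derivative of S of [H] minus [Tfull]. The first summand of
    [Tcorr] and the subtracted term give -3/4 of a volume form contracted with S, that is, three
    times [D]; symmetrized in i and j, the other two summands give -2 times [D]. *)
Lemma sum_corr_DE i j k :
  \sum_a \sum_b ((Tcorr k a b i - \sum_m h a b m * w k m i) * h a b j
    + h a b i * (Tcorr k a b j - \sum_m h a b m * w k m j)) = D i j k.
Proof.
rewrite /D /S /Tcorr !sum3.
have wE := volume_tensorE hw; have hE := symmetric_tracelessE hh.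
move: i j k; do 3![apply: ind3]; rewrite !wE !hE; by field.
Qed.

Lemma covariant_derivative_SE i j k :
  \sum_a \sum_b (H k a b i * h a b j + h a b i * H k a b j) =
  P i j k + P j i k + D i j k.
Proof.
rewrite -sum_corr_DE -!big_split; apply: eq_bigr => a _.
rewrite -!big_split; apply: eq_bigr => b _ /=.
(* Total symmetry carries the derivative index k to the last place, where [P] has it. *)
have T4 l : Tfull a b l k = Tfull k a b l.
  by rewrite Tfull_swap34 Tfull_swap23 Tfull_swap12.
rewrite !T4 /Tfull /dsff; ring.
Qed.
End SecondFundamentalForm.

Section QuadraticIdentity.
Variables (w P : 'I_3 -> 'I_3 -> 'I_3 -> R) (S : 'I_3 -> 'I_3 -> R).
Hypotheses (hw : volume_tensor w) (S12 : forall i j, S i j = S j i).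
Hypothesis P23 : forall i j k, P i j k = P i k j.

(** By P_ijk = P_ikj and relabelling, three of the four products of P terms become the sum of P_ijk
    P_jik, whence the 3. For fixed k, [D] is 1/4 of the commutator of S with a skew matrix, so it
    kills multiples of the identity; accordingly s^2 - 3 q is -3 times the squared norm of the
    trace-free part of S. *)
Lemma quadratic_identity :
  let D i j k := 4^-1 * \sum_m (w k i m * S m j + w k j m * S i m) in
  let dS i j k := P i j k + P j i k + D i j k in
  let W i j := \sum_a \sum_b w i a b * P a b j in
  let A i j := 2^-1 * (W i j + W j i) in
  \sum_i \sum_j \sum_k dS i j k * dS i k j =
    (\sum_i \sum_j \sum_k P i j k ^+ 2)
    + 3 * (\sum_i \sum_j \sum_k P i j k * P j i k)
    + 2^-1 * (\sum_i \sum_j A i j * S i j)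
    + 16^-1 * ((\sum_i S i i) ^+ 2 - 3 * \sum_i \sum_j S i j * S j i).
Proof.
move=> /=; rewrite !sum3 !(volume_tensorE hw).
rewrite !(P23 _ i1 i0) !(P23 _ i2 i0) !(P23 _ i2 i1).
rewrite (S12 i1 i0) (S12 i2 i0) (S12 i2 i1); by field.
Qed.
End QuadraticIdentity.

(** The connection terms acting on the contracted indices a and b cancel by skewness; those acting
    on i and j are the ones subtracted on the left. *)
Lemma covariant_derivative_squares (h : 'I_3 -> 'I_3 -> 'I_3 -> R)
    (dH : 'I_3 -> 'I_3 -> 'I_3 -> R) (g : 'I_3 -> 'I_3 -> R) i j :
  (forall a b, g a b = - g b a) ->
  let S i j := \sum_a \sum_b h a b i * h a b j in
  let H a b i := dH a b i
    - \sum_m (g a m * h m b i + g b m * h a m i + g i m * h a b m) in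
  \sum_a \sum_b (dH a b i * h a b j + h a b i * dH a b j)
    - \sum_m g i m * S m j - \sum_m g j m * S i m =
  \sum_a \sum_b (H a b i * h a b j + h a b i * H a b j).
Proof.
move=> gN /=; have g0 a : g a a = 0 by have := gN a a; lra.
rewrite !sum3 !g0 (gN i1 i0) (gN i2 i0) (gN i2 i1); ring.
Qed.

(** The bracket on the right of the hypothesis supplies the connection terms of the first slot;
    skewness turns G k m i into the connection term of the slot i. *)
Lemma codazzi_rearrange (G h w : 'I_3 -> 'I_3 -> 'I_3 -> R) (p q : R) k a b i :
  (forall i j m, G i j m = - G i m j) ->
  (\sum_m G a b m * h k m i + (p + \sum_m h a b m * (w k m i + G k m i)))
  - (\sum_m G k b m * h a m i + (q + \sum_m h k b m * (w a m i + G a m i))) =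
    \sum_m (G k a m - G a k m) * h m b i ->
  p - \sum_m (G k a m * h m b i + G k b m * h a m i + G k i m * h a b m)
    + \sum_m h a b m * w k m i =
  q - \sum_m (G a k m * h m b i + G a b m * h k m i + G a i m * h k b m)
    + \sum_m h k b m * w a m i.
Proof.
move=> GN; have Gk m : G k i m = - G k m i by exact: GN.
have Ga m : G a i m = - G a m i by exact: GN.
rewrite !sum3 !Gk !Ga; lra.
Qed.

End ThreeDimensionalTensors.

(** * Lagrangian immersions in an orthonormal frame *)

Lemma ord3_ind (P : 'I_3 -> Prop) :
  P (inord 0) -> P (inord 1) -> P (inord 2) -> forall i, P i.
Proof.
by move=> P0 P1 P2 i; rewrite -(inord_val i); case: i => [[|[|[|//]]] ?].
Qed.

Lemma sum3E (R : nmodType) (F : 'I_3 -> R) :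
  \sum_i F i = F (inord 0) + F (inord 1) + F (inord 2).
Proof.
rewrite !big_ord_recl big_ord0 addr0 -addrA.
by do !congr (_ + _); congr (F _); apply/val_inj; rewrite /= inordK.
Qed.

Lemma sum_deltaM (R : pzRingType) n (F : 'I_n -> R) i :
  \sum_j F j * (j == i)%:R = F i.
Proof.
rewrite (bigD1 i)//= eqxx mulr1 big1 ?addr0// => j /negPf ->.
by rewrite mulr0.
Qed.

Section GtensorFormula.
Variable R : realType.
Implicit Types x X Y w : 'rV[R]_7.

(** As z * z = 0, J applied to the extension of Y is z * Y, with derivative X * Y. The extension
    itself has derivative -<Y, X> x, which is normal to the sphere and so is projected away. *)
Lemma GtensorE x X Y : dot x x = 1 -> dot Y x = 0 ->
  Gtensor x X Y = cross X Y - dot (cross X Y) x *: x.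
Proof.
move=> xx Yx; have did := is_derive_id x X; have dY := is_derive_cst Y x X.
have d1 : is_derive x X (fun z => acs z (tangent_ext Y z)) (cross X Y).
  rewrite (_ : (fun z => _) = fun z => cross z Y); last first.
    apply/funext => z; rewrite /acs /tangent_ext crossDr -scaleNr crossZr.
    by rewrite crossxx scaler0 addr0.
  by have := is_derive_cross did dY; rewrite cross0r addr0.
have d2 : is_derive x X (tangent_ext Y) (- dot Y X *: x).
  have dz := is_derive_scale (is_derive_dot dY did) did.
  have := is_deriveB dY dz.
  by rewrite sub0r dot0l add0r /cst Yx scale0r addr0 scaleNr.
rewrite /Gtensor /nablaS (@derive_val _ _ _ _ _ _ _ d1).
rewrite (@derive_val _ _ _ _ _ _ _ d2) /= (dotZl (- dot Y X)) xx mulr1 subrr.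
by rewrite /acs cross0r subr0.
Qed.

Lemma dot_Gtensor x X Y w : dot x x = 1 -> dot Y x = 0 ->
  dot (Gtensor x X Y) (cross x w) = dot (cross X Y) (cross x w).
Proof.
move=> xx Yx; rewrite GtensorE// dotBl (dotZl (dot _ _) x).
by rewrite -(dot_cross_cycle x) crossxx dot0l mulr0 subr0.
Qed.

End GtensorFormula.

Section LagrangianFrame.
Variables (R : realType) (U : set 'rV[R]_3) (f : 'rV[R]_3 -> 'rV[R]_7).
Variables (nabla : ('rV[R]_3 -> 'rV[R]_3) -> ('rV[R]_3 -> 'rV[R]_3) ->
             'rV[R]_3 -> 'rV[R]_3) (e : 'I_3 -> 'rV[R]_3 -> 'rV[R]_3).
Hypothesis oU : open U.
Hypothesis sf : smooth_on U f.
Hypothesis f_sphere : forall z, dot (f z) (f z) = 1.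
Hypothesis f_inj : forall z, U z -> injective ('d f z).
Hypothesis f_lag : forall z, U z -> forall u v,
  dot (cross (f z) ('d f z u)) ('d f z v) = 0.
Hypothesis hnabla : levi_civita U (induced_metric f) nabla.
Hypothesis he : oriented_orthonormal_frame f U e.

Local Notation V := 'rV[R]_3.
Local Notation E := (fun i => push f (e i)).
Local Notation JE := (fun i => Jpush f (e i)).
Definition DE i j (z : V) := 'D_(e i z) (push f (e j)) z.

Lemma smooth_e i : smooth_on U (e i). Proof. by case: he. Qed.
Hint Resolve smooth_e : core.

Lemma differentiable_f z : U z -> differentiable f z.
Proof. exact: smooth_diff. Qed.

Lemma smooth_push X : smooth_on U X -> smooth_on U (push f X).
Proof.
move=> sX; apply: smooth_eq (smooth_derive oU sX sf) => // z Uz.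
by rewrite deriveE//; exact: differentiable_f.
Qed.

Lemma smooth_E i : smooth_on U (push f (e i)). Proof. exact: smooth_push. Qed.
Hint Resolve smooth_E : core.

Lemma smooth_DE i j : smooth_on U (DE i j). Proof. exact: smooth_derive. Qed.
Hint Resolve smooth_DE : core.

Lemma is_derive_f z i : U z -> is_derive z (e i z) f (E i z).
Proof.
move=> Uz; have := smooth_is_derive (e i z) sf Uz.
by rewrite deriveE//; exact: differentiable_f.
Qed.

Lemma is_derive_E z i j : U z -> is_derive z (e i z) (E j) (DE i j z).
Proof. by move=> Uz; exact: smooth_is_derive (smooth_E j) Uz. Qed.

Lemma is_derive_JE z i j : U z -> is_derive z (e i z) (JE j)
  (cross (E i z) (E j z) + cross (f z) (DE i j z)).
Proof.
by move=> Uz; apply: is_derive_cross; [exact: is_derive_f|exact: is_derive_E].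
Qed.

Lemma dot_EE z i j : U z -> dot (E i z) (E j z) = (i == j)%:R.
Proof. by case: he => _ + _ => /[apply]; exact. Qed.

Lemma dot_df_f z v : U z -> dot ('d f z v) (f z) = 0.
Proof.
move=> Uz; have dfz := smooth_is_derive v sf Uz.
have := is_derive_dot dfz dfz => h0.
have : 'D_v (fun t => dot (f t) (f t)) z = 0.
  rewrite (_ : (fun t => _) = cst 1) ?derive_cst//.
  by apply/funext => t; exact: f_sphere.
rewrite derive_val (deriveE _ (differentiable_f Uz)) (dotC (f z)).
by move: (dot _ _) => a; lra.
Qed.

Lemma dot_Ef z i : U z -> dot (E i z) (f z) = 0.
Proof. exact: dot_df_f. Qed.

Lemma dot_JEf z i : U z -> dot (JE i z) (f z) = 0.
Proof.
by move=> Uz; rewrite /Jpush /acs dotC -dot_cross_cycle crossxx dot0l.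
Qed.

Lemma dot_df_JE z i v : U z -> dot ('d f z v) (JE i z) = 0.
Proof. by move=> Uz; rewrite dotC; exact: f_lag. Qed.

Lemma dot_E_JE z i j : U z -> dot (E i z) (JE j z) = 0.
Proof. exact: dot_df_JE. Qed.

Lemma dot_cross_f z u v : dot v (f z) = 0 ->
  dot (cross (f z) u) (cross (f z) v) = dot u v.
Proof.
move=> vf; rewrite dot_cross_cross f_sphere mul1r (dotC (f z) v) vf mulr0.
by rewrite subr0.
Qed.

Lemma dot_JEJE z i j : U z -> dot (JE i z) (JE j z) = (i == j)%:R.
Proof.
by move=> Uz; rewrite -(dot_EE i j Uz); apply: dot_cross_f; exact: dot_Ef.
Qed.

(** The orthogonality relations of the frame hold only on U; this is what allows them to be
    differentiated. *)
Lemma is_derive_cst_on (g : V -> R) z v (a d : R) : U z ->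
  (forall t, U t -> g t = a) -> is_derive z v g d -> d = 0.
Proof.
move=> Uz ga dg; rewrite -(@derive_val _ _ _ _ _ _ _ dg).
by rewrite (derive_near _ oU Uz ga); exact: derive_cst.
Qed.

(** * Connection coefficients and second fundamental form in the frame *)

Definition Gam i j m z := dot (DE i j z) (E m z).
Definition hcoef i j k z := dot (DE i j z) (JE k z).
(** The associative 3-form of R^7 restricted to M. *)
Definition phi i j k z := dot (E i z) (cross (E j z) (E k z)).

Lemma dot_DE_f z i j : U z -> dot (DE i j z) (f z) = - (i == j)%:R.
Proof.
move=> Uz; have h := is_derive_dot (is_derive_E i j Uz) (is_derive_f i Uz).
have := is_derive_cst_on Uz (fun t Ut => dot_Ef j Ut) h.
by rewrite dot_EE// eq_sym; lra.
Qed.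

Lemma Gam_antisym z i j m : U z -> Gam i j m z = - Gam i m j z.
Proof.
move=> Uz; have h := is_derive_dot (is_derive_E i j Uz) (is_derive_E i m Uz).
have := is_derive_cst_on Uz (fun t Ut => dot_EE j m Ut) h.
rewrite (dotC (push f (e j) z)) -/(Gam i j m z) -/(Gam i m j z).
by move: (Gam _ _ _ _) (Gam _ _ _ _) => a b; lra.
Qed.

(** On U, E_j is the derivative of f along e_j, so the left side is a commutator of derivatives of
    f. *)
Lemma DE_bracket z i j : U z -> DE i j z - DE j i z =
  'd f z (nabla (e i) (e j) z - nabla (e j) (e i) z).
Proof.
move=> Uz; rewrite (lc_torsion_free hnabla)// -deriveE; last first.
  exact: differentiable_f.
have := derive_commutator oU Uz (smooth_e i) (smooth_e j) sf.
have Dl k l : 'D_(e k z) (fun t => 'D_(e l t) f t) z = DE k l z.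
  apply: (derive_near _ oU Uz) => t Ut.
  by rewrite deriveE//; exact: differentiable_f.
by rewrite !Dl.
Qed.

Lemma hcoef_swap12 z i j k : U z -> hcoef i j k z = hcoef j i k z.
Proof.
move=> Uz; apply/eqP; rewrite -subr_eq0 -dotBl DE_bracket//; apply/eqP.
exact: dot_df_JE.
Qed.

(** The term E_i * E_k in the derivative of f * E_k, coming from the moving base point, is the
    failure of J to be parallel; it is the source of [phi]. *)
Lemma hcoef_sub_swap23 z i j k : U z ->
  hcoef i j k z - hcoef i k j z = phi i j k z.
Proof.
move=> Uz; have h := is_derive_dot (is_derive_E i j Uz) (is_derive_JE i k Uz).
have := is_derive_cst_on Uz (fun t Ut => dot_E_JE j k Ut) h.
have e1 : dot (E j z) (cross (E i z) (E k z)) = - phi i j k z.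
  by rewrite -dot_cross_cycle crossC dotNl dot_cross_cycle.
have e2 : dot (E j z) (cross (f z) (DE i k z)) = - hcoef i k j z.
  by rewrite -dot_cross_cycle crossC dotNl dotC.
rewrite dotDr e1 e2 -/(hcoef i j k z).
by move: (phi _ _ _ _) (hcoef _ _ _ _) (hcoef _ _ _ _) => a b c; lra.
Qed.

Lemma phi_cycle i j k z : phi i j k z = phi j k i z.
Proof. by rewrite /phi dotC dot_cross_cycle. Qed.

(* The Kaehler form vanishes on M, and so does its differential, 3 phi. *)
Lemma phi_eq0 z i j k : U z -> phi i j k z = 0.
Proof.
move=> Uz.
have gen (p a b c a' b' c' : R) : a = b' -> b = c' -> c = a' ->
    a - a' = p -> b - b' = p -> c - c' = p -> p = 0 by lra.
apply: (gen _ _ _ _ _ _ _ (hcoef_swap12 i j k Uz) (hcoef_swap12 j k i Uz)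
  (hcoef_swap12 k i j Uz)).
- exact: hcoef_sub_swap23.
- by rewrite (phi_cycle i j k); exact: hcoef_sub_swap23.
- by rewrite -(phi_cycle k i j); exact: hcoef_sub_swap23.
Qed.

Lemma hcoef_swap23 z i j k : U z -> hcoef i j k z = hcoef i k j z.
Proof.
move=> Uz; apply/eqP.
by rewrite -subr_eq0 (hcoef_sub_swap23 i j k Uz) (phi_eq0 i j k Uz).
Qed.

Lemma frame_expansion z w : U z -> w = dot w (f z) *: f z
  + \sum_i dot w (E i z) *: E i z + \sum_i dot w (JE i z) *: JE i z.
Proof.
move=> Uz.
pose b (i : 'I_(1 + (3 + 3))) := match fintype.split i with
  | inl _ => f z
  | inr j => match fintype.split j with inl k => E k z | inr k => JE k z end
  end.
have bl k : b (lshift _ k) = f z by rewrite /b (unsplitK (inl k)).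
have brl k : b (rshift _ (lshift _ k)) = E k z.
  by rewrite /b (unsplitK (inr _)) (unsplitK (inl k)).
have brr k : b (rshift _ (rshift _ k)) = JE k z.
  by rewrite /b (unsplitK (inr _)) (unsplitK (inr k)).
suff : w = \sum_(i < 1 + (3 + 3)) dot w (b i) *: b i.
  rewrite big_split_ord big_split_ord /= big_ord1 bl -addrA => {1}->.
  by congr (_ + (_ + _)); apply: eq_bigr => i _; rewrite ?brl ?brr.
apply: orthonormal_expansion.
(* 7 and 1 + (3 + 3) are convertible; the split form of the index separates f, the E_k and the J
   E_k. *)
change (forall i j : 'I_(1 + (3 + 3)), dot (b i) (b j) = (i == j)%:R) => i j.
case: (split_ordP i) => {}i ->; last case: (split_ordP i) => {}i ->;
  (case: (split_ordP j) => {}j ->; last case: (split_ordP j) => {}j ->);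
  rewrite ?bl ?brl ?brr ?eq_lshift ?eq_rshift ?eq_lrshift ?eq_rlshift
    ?eq_lshift ?eq_rshift ?eq_lrshift ?eq_rlshift.
- by rewrite f_sphere !ord1.
- by rewrite dotC (dot_Ef j Uz).
- by rewrite dotC (dot_JEf j Uz).
- exact: dot_Ef.
- exact: dot_EE.
- exact: dot_E_JE.
- exact: dot_JEf.
- by rewrite dotC; exact: dot_E_JE.
- exact: dot_JEJE.
Qed.

Definition omcoef i j k z := dot (cross (E i z) (E j z)) (JE k z).

Lemma omegacE z i j k : U z -> omegac f e i j k z = omcoef i j k z.
Proof.
by move=> Uz; apply: dot_Gtensor; rewrite ?f_sphere//; exact: dot_Ef.
Qed.

Lemma omcoef_swap12 i j k z : omcoef i j k z = - omcoef j i k z.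
Proof. by rewrite /omcoef crossC dotNl. Qed.

(** Both sides are components along f of double products of the E's; by [cross_cross_polar] their
    difference is a combination of the E's, which are orthogonal to f. *)
Lemma omcoef_cycle z i j k : U z -> omcoef i j k z = omcoef j k i z.
Proof.
move=> Uz.
have omE a b c : omcoef a b c z =
    dot (f z) (cross (E c z) (cross (E a z) (E b z))).
  by rewrite /omcoef dotC dot_cross_cycle.
rewrite !omE (crossC (E j z) (E k z)) crossNr dotNr.
apply/eqP; rewrite -addr_eq0 -dotDr cross_cross_polar dotBr dotDr !dotZr.
by rewrite !(dotC (f z)) !(dot_Ef _ Uz) !mulr0 addr0 subrr.
Qed.

(** The f-component vanishes because M is Lagrangian, and the tangent component is [phi]. This is
    the normality of G(X, Y). *)
Lemma cross_EE z i j : U z ->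
  cross (E i z) (E j z) = \sum_k omcoef i j k z *: JE k z.
Proof.
move=> Uz; rewrite [LHS](frame_expansion _ Uz).
have -> : dot (cross (E i z) (E j z)) (f z) = 0.
  by rewrite dot_cross_cycle (crossC _ (f z)) dotNr (dot_E_JE i j Uz) oppr0.
rewrite scale0r add0r big1 ?add0r// => k _.
by rewrite dotC -[dot _ _]/(phi k i j z) (phi_eq0 k i j Uz) scale0r.
Qed.

(** E_0 * E_1 is a unit vector proportional to J E_2, so omega_012 is 1 or -1; the orientation of
    the frame selects 1. *)
Lemma omcoef_volume z : U z ->
  volume_tensor (inord 0) (inord 1) (inord 2) (fun i j k => omcoef i j k z).
Proof.
move=> Uz; split=> [i j k|i j k|].
- exact: omcoef_swap12.
- exact: omcoef_cycle.
have [_ _ /(_ z Uz)] := he; rewrite -[omega _ _ _ _ _]/(omegac f e _ _ _ _).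
rewrite omegacE// => om_gt0.
have : dot (cross (E (inord 0) z) (E (inord 1) z))
           (cross (E (inord 0) z) (E (inord 1) z)) = 1.
  rewrite dot_cross_cross !(dot_EE _ _ Uz) !eqxx -val_eqE /= !inordK//=.
  by rewrite mulr1 mulr0 subr0.
have om1 i j : omcoef i j j z = 0.
  rewrite omcoef_cycle//; have := omcoef_swap12 j j i z.
  by move: (omcoef _ _ _ _) => a; lra.
have om0 i j : omcoef i j i z = 0 by rewrite omcoef_swap12 om1 oppr0.
rewrite [X in dot _ X]cross_EE// dot_sumr sum3E.
have sq i j k : dot (cross (E i z) (E j z)) (omcoef i j k z *: JE k z) =
  omcoef i j k z ^+ 2 by rewrite (dotZr (omcoef i j k z) _ (JE k z)) expr2.
rewrite !sq om0 om1 expr0n /= !add0r.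
move: om_gt0; move: (omcoef _ _ _ _) => a a0.
by move=> /eqP; rewrite sqrf_eq1 => /orP[/eqP//|/eqP a1]; lra.
Qed.

(** Differentiate <E_0 * E_1, E_2> = 0 along e_k. Cycling each term to isolate its derivative pairs
    that derivative with the product of the two other vectors, which is J of the differentiated one;
    this gives sum_m h_kmm = 0. *)
Lemma hcoef_trace z k : U z -> \sum_m hcoef m m k z = 0.
Proof.
move=> Uz.
have h := is_derive_dot (is_derive_cross (is_derive_E k (inord 0) Uz)
  (is_derive_E k (inord 1) Uz)) (is_derive_E k (inord 2) Uz).
have := is_derive_cst_on Uz (fun t Ut =>
  etrans (dot_cross_cycle _ _ _) (phi_eq0 (inord 0) (inord 1) (inord 2) Ut)) h.
have crossE a b c :
   omcoef a b c z = 1 -> omcoef a b a z = 0 -> omcoef a b b z = 0 ->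
   (forall F : 'I_3 -> 'rV[R]_7, \sum_i F i = F a + F b + F c) ->
   cross (E a z) (E b z) = JE c z.
  move=> c1 a0 b0 S; rewrite cross_EE// S a0 b0 c1 !scale0r !add0r.
  exact: scale1r.
have wE := volume_tensorE (omcoef_volume Uz).
have -> : cross (E (inord 0) z) (E (inord 1) z) = JE (inord 2) z.
  by apply: crossE; rewrite ?wE// => F; exact: sum3E.
rewrite dotDl dot_cross_cycle.
have -> : cross (E (inord 1) z) (E (inord 2) z) = JE (inord 0) z.
  by apply: crossE; rewrite ?wE// => F; rewrite sum3E -addrA addrC.
rewrite (crossC (E (inord 0) z)) dotNl dot_cross_cycle -dotNr -crossC.
have -> : cross (E (inord 2) z) (E (inord 0) z) = JE (inord 1) z.
  by apply: crossE; rewrite ?wE// => F; rewrite sum3E addrC addrA.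
rewrite (dotC (JE (inord 2) z)).
rewrite -/(hcoef k _ _ z) -/(hcoef k _ _ z) -/(hcoef k _ _ z).
have sw m : hcoef k m m z = hcoef m m k z.
  by rewrite (hcoef_swap12 k m m Uz) (hcoef_swap23 m k m Uz).
by rewrite !sw sum3E.
Qed.

Lemma df_expansion z v : U z ->
  'd f z v = \sum_m dot ('d f z v) (E m z) *: E m z.
Proof.
move=> Uz; rewrite [LHS](frame_expansion _ Uz) dot_df_f// scale0r add0r.
rewrite [X in _ + X]big1 ?addr0// => m _.
by rewrite (dot_df_JE m v Uz) scale0r.
Qed.

(* Uniqueness of the Levi-Civita connection: the difference of the two
   connections is symmetric in (i, j) and skew in (j, m). *)
Lemma dot_df_nabla z i j m : U z ->
  dot ('d f z (nabla (e i) (e j) z)) (E m z) = Gam i j m z.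
Proof.
move=> Uz.
pose N a b := 'd f z (nabla (e a) (e b) z).
pose d a b c := Gam a b c z - dot (N a b) (E c z).
have d12 a b c : d a b c = d b a c.
  rewrite /d /Gam -!dotBl; congr dot.
  have := DE_bracket a b Uz; rewrite linearB => DB.
  rewrite -[DE a b z](subrK (DE b a z)) DB -/(N a b) -/(N b a).
  by rewrite addrAC (addrC (N a b)) addrK addrC.
have d23 a b c : d a b c = - d a c b.
  have := lc_metric hnabla (smooth_e a) (smooth_e b) (smooth_e c) Uz.
  have -> : 'D_(e a z) (fun t => induced_metric f t (e b t) (e c t)) z = 0.
    rewrite (derive_near _ oU Uz (fun t Ut => dot_EE b c Ut)).
    exact: derive_cst.
  rewrite /d (Gam_antisym a b c Uz) /induced_metric.
  rewrite (dotC ('d f z (e b z))) -/(N a b) -/(N a c).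
  rewrite -/(push f (e c) z) -/(push f (e b) z).
  by move: (dot _ _) (dot _ _) (Gam _ _ _ _) => p q r; lra.
suff : d i j m = 0 by rewrite /d => /subr0_eq.
have : d i j m = - d i j m.
  by rewrite {1}d12 d23 d12 d23 opprK d12 d23.
by move: (d _ _ _) => p; lra.
Qed.

Lemma df_nabla z i j : U z ->
  'd f z (nabla (e i) (e j) z) = \sum_m Gam i j m z *: E m z.
Proof.
move=> Uz; rewrite [LHS]df_expansion//; apply: eq_bigr => m _.
by rewrite (dot_df_nabla i j m Uz).
Qed.

Lemma nabla_bracket z i j : U z ->
  nabla (e i) (e j) z - nabla (e j) (e i) z =
  \sum_m (Gam i j m z - Gam j i m z) *: e m z.
Proof.
move=> Uz; apply: (f_inj Uz); rewrite linearB !df_nabla// -sumrB linear_sum.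
by apply: eq_bigr => m _; rewrite [RHS]linearZ /= scalerBl.
Qed.

(** * The Gauss formula and its consequences *)

Lemma gauss z i j : U z -> DE i j z = \sum_m Gam i j m z *: E m z
   + \sum_m hcoef i j m z *: JE m z - (i == j)%:R *: f z.
Proof.
move=> Uz; rewrite [LHS](frame_expansion _ Uz) dot_DE_f// scaleNr addrC.
by rewrite addrCA addrA addrC addrA addrAC.
Qed.

Lemma sff_frame z i j : U z ->
  sff f nabla (e i) (e j) z = \sum_m hcoef i j m z *: JE m z.
Proof.
move=> Uz; rewrite /sff /nablaS df_nabla// -/(DE i j z) dot_DE_f// {1}gauss//.
rewrite scaleNr opprK subrK addrAC subrr add0r //.
Qed.

Lemma dot_sff z k X Y : U z ->
  dot (sff f nabla X Y z) (JE k z) = dot ('D_(X z) (push f Y) z) (JE k z).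
Proof.
move=> Uz; rewrite /sff /nablaS !dotBl (dot_df_JE _ _ Uz) subr0 dotZl.
by rewrite (dotC (f z)) (dot_JEf k Uz) mulr0 subr0.
Qed.

Lemma hcE z i j k : U z -> hc f nabla e i j k z = hcoef i j k z.
Proof. exact: dot_sff. Qed.

Lemma nablaE z i j : U z -> nabla (e i) (e j) z = \sum_m Gam i j m z *: e m z.
Proof.
move=> Uz; apply: (f_inj Uz); rewrite df_nabla// linear_sum.
by apply: eq_bigr => m _; rewrite [RHS]linearZ.
Qed.

Lemma derive_E_sum z j (a : 'I_3 -> R) : U z ->
  'D_(\sum_m a m *: e m z) (push f (e j)) z = \sum_m a m *: DE m j z.
Proof.
move=> Uz; have dE := smooth_diff (smooth_E j) Uz.
rewrite deriveE// linear_sum; apply: eq_bigr => m _.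
by rewrite linearZ /= /DE deriveE.
Qed.

Lemma dot_derive_E_sum z j l (a : 'I_3 -> R) : U z ->
  dot ('D_(\sum_m a m *: e m z) (push f (e j)) z) (JE l z) =
  \sum_m a m * hcoef m j l z.
Proof.
move=> Uz; rewrite derive_E_sum// dot_suml; apply: eq_bigr => m _.
exact: dotZl.
Qed.

Definition dhcoef k a b l z := 'D_(e k z) (hcoef a b l) z.

Lemma is_derive_hcoef z k a b l : U z ->
  is_derive z (e k z) (hcoef a b l) (dhcoef k a b l z).
Proof.
move=> Uz; apply: derivableP.
have := is_derive_dot (smooth_is_derive (e k z) (smooth_DE a b) Uz)
  (is_derive_JE k l Uz).
by case.
Qed.

Lemma is_derive_Gam z k a b l : U z ->
  is_derive z (e k z) (Gam a b l) ('D_(e k z) (Gam a b l) z).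
Proof.
move=> Uz; apply: derivableP.
have := is_derive_dot (smooth_is_derive (e k z) (smooth_DE a b) Uz)
  (is_derive_E k l Uz).
by case.
Qed.

Lemma dot_JE z l (a : 'I_3 -> R) : U z ->
  dot (\sum_m a m *: JE m z) (JE l z) = a l.
Proof.
move=> Uz; rewrite dot_suml -[RHS]sum_deltaM; apply: eq_bigr => m _.
by rewrite (dotZl (a m) (JE m z)) (dot_JEJE m l Uz).
Qed.

Lemma is_derive_sum_E z k (a : 'I_3 -> V -> R) (da : 'I_3 -> R) : U z ->
  (forall m, is_derive z (e k z) (a m) (da m)) ->
  is_derive z (e k z) (fun t => \sum_m a m t *: E m t)
    (\sum_m (da m *: E m z + a m z *: DE k m z)).
Proof.
move=> Uz ha; apply: is_derive_fsum => m; apply: is_derive_scale => //.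
exact: is_derive_E.
Qed.

Lemma is_derive_sum_JE z k (a : 'I_3 -> V -> R) (da : 'I_3 -> R) : U z ->
  (forall m, is_derive z (e k z) (a m) (da m)) ->
  is_derive z (e k z) (fun t => \sum_m a m t *: JE m t)
    (\sum_m (da m *: JE m z
      + a m z *: (cross (E k z) (E m z) + cross (f z) (DE k m z)))).
Proof.
move=> Uz ha; apply: is_derive_fsum => m; apply: is_derive_scale => //.
exact: is_derive_JE.
Qed.

Lemma dot_derive_sum_E z k l (a da : 'I_3 -> R) : U z ->
  dot (\sum_m (da m *: E m z + a m *: DE k m z)) (JE l z) =
  \sum_m a m * hcoef k m l z.
Proof.
move=> Uz; rewrite dot_suml; apply: eq_bigr => m _.
rewrite dotDl (dotZl (da m) (E m z)) (dot_E_JE m l Uz) mulr0 add0r.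
exact: dotZl.
Qed.

Lemma dot_derive_sum_JE z k l (a da : 'I_3 -> R) : U z ->
  dot (\sum_m (da m *: JE m z
    + a m *: (cross (E k z) (E m z) + cross (f z) (DE k m z)))) (JE l z) =
  da l + \sum_m a m * (omcoef k m l z + Gam k m l z).
Proof.
move=> Uz; rewrite big_split dotDl (dot_JE l da Uz) dot_suml.
congr (_ + _); apply: eq_bigr => m _.
rewrite (dotZl (a m)) dotDl; congr (_ * (_ + _)).
by apply: dot_cross_f; exact: dot_Ef.
Qed.

(** Differentiate the Gauss formula. Its f-term contributes a multiple of E_k, invisible to J E_l;
    the tangential part contributes through h, and the normal part through the derivative of J
    E_m. *)
Lemma dot_derive_DE z k i j l : U z ->
  dot ('D_(e k z) (DE i j) z) (JE l z) =
  \sum_m Gam i j m z * hcoef k m l z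
  + (dhcoef k i j l z + \sum_m hcoef i j m z * (omcoef k m l z + Gam k m l z)).
Proof.
move=> Uz; rewrite (derive_near _ oU Uz (fun t Ut => gauss i j Ut)).
have h1 := is_derive_sum_E Uz (fun m => is_derive_Gam k i j m Uz).
have h2 := is_derive_sum_JE Uz (fun m => is_derive_hcoef k i j m Uz).
have h3 := is_derive_scale (is_derive_cst ((i == j)%:R : R) z (e k z))
  (is_derive_f k Uz).
have h4 := is_deriveB (is_deriveD h1 h2) h3.
apply: etrans (congr1 (fun w => dot w (JE l z))
  (@derive_val _ _ _ _ _ _ _ h4)) _.
rewrite dotBl dotDl.
rewrite (dot_derive_sum_E _ _ (fun m => Gam i j m z))//.
rewrite (dot_derive_sum_JE _ _ (fun m => hcoef i j m z))//.
rewrite scale0r add0r (dotZl _ (E k z)) (dot_E_JE k l Uz) mulr0 subr0.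
by [].
Qed.

(** * The covariant derivative of h and the Codazzi equation *)

Definition covh k a b i z := dhcoef k a b i z
  - \sum_m (Gam k a m z * hcoef m b i z + Gam k b m z * hcoef a m i z
            + Gam k i m z * hcoef a b m z).

Lemma dhcoef_swap12 z k a b i : U z -> dhcoef k a b i z = dhcoef k b a i z.
Proof.
by move=> Uz; apply: (derive_near _ oU Uz) => t Ut; exact: hcoef_swap12.
Qed.

Lemma dhcoef_swap23 z k a b i : U z -> dhcoef k a b i z = dhcoef k a i b z.
Proof.
by move=> Uz; apply: (derive_near _ oU Uz) => t Ut; exact: hcoef_swap23.
Qed.

Lemma covh_swap23 z k a b i : U z -> covh k a b i z = covh k b a i z.
Proof.
move=> Uz; rewrite /covh (dhcoef_swap12 k a b i Uz); congr (_ - _).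
apply: eq_bigr => m _; rewrite (hcoef_swap12 m b i Uz) (hcoef_swap12 a m i Uz).
by rewrite (hcoef_swap12 a b m Uz) [X in X + _]addrC.
Qed.

Lemma covh_swap34 z k a b i : U z -> covh k a b i z = covh k a i b z.
Proof.
move=> Uz; rewrite /covh (dhcoef_swap23 k a b i Uz); congr (_ - _).
apply: eq_bigr => m _; rewrite (hcoef_swap23 m b i Uz) (hcoef_swap23 a m i Uz).
by rewrite (hcoef_swap23 a b m Uz) addrAC.
Qed.

Lemma codazzi_frame z k a b i : U z ->
  covh k a b i z + \sum_m hcoef a b m z * omcoef k m i z =
  covh a k b i z + \sum_m hcoef k b m z * omcoef a m i z.
Proof.
move=> Uz.
have C := derive_commutator oU Uz (smooth_e k) (smooth_e a) (smooth_E b).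
have T := etrans (esym (lc_torsion_free hnabla (smooth_e k) (smooth_e a) Uz))
  (nabla_bracket k a Uz).
have {}C := etrans C (congr1 (fun v => 'D_v (push f (e b)) z) T).
have {}C := etrans (congr1 (fun w => dot w (JE i z)) C)
  (dot_derive_E_sum b i (fun m => Gam k a m z - Gam a k m z) Uz).
have {}C := etrans (esym (dotBl _ _ _)) C.
(* [C] is now the J E_i component of the commutation of flat derivatives of E_b, with the bracket
   expressed through [Gam]. *)
have {}C := etrans (esym (congr2 (fun p q => p - q) (dot_derive_DE k a b i Uz)
  (dot_derive_DE a k b i Uz))) C.
exact: (codazzi_rearrange (@sum3E R) (G := fun i j m => Gam i j m z)
  (h := fun i j m => hcoef i j m z) (w := fun i j m => omcoef i j m z)
  (fun i j m => Gam_antisym i j m Uz) C).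
Qed.

(** * Components of the normal derivative of h, of T and of the derivative of S *)

Lemma dot_nabla_perp z k l xi d : U z -> is_derive z (e k z) xi d ->
  dot (nabla_perp f e (e k) xi z) (JE l z) = dot d (JE l z).
Proof.
move=> Uz dxi; rewrite /nabla_perp /nablaS (@derive_val _ _ _ _ _ _ _ dxi).
set w := d - _; rewrite dotBl dot_suml big1 => [|m _]; last first.
  by rewrite (dotZl _ (E m z)) (dot_E_JE m l Uz) mulr0.
by rewrite subr0 dotBl (dotZl _ (f z)) (dotC (f z)) (dot_JEf l Uz) mulr0 subr0.
Qed.

(** The normal derivative of J E_m is G(e_k, e_m) plus J of the induced derivative of e_m. The first
    term gives the omega sum, the second completes [covh] in its last slot. *)
Lemma dot_nabla_sff z k a b l : U z ->
  dot (nabla_sff f nabla e (e k) (e a) (e b) z) (JE l z) =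
  covh k a b l z + \sum_m hcoef a b m z * omcoef k m l z.
Proof.
move=> Uz; apply: etrans (dotBl _ _ _) _; rewrite [X in X - _]dotBl.
have h1 := is_derive_sum_JE Uz (fun m => is_derive_hcoef k a b m Uz).
have {}h1 := is_derive_near oU Uz (fun t Ut => esym (sff_frame a b Ut)) h1.
have h2 := is_derive_sum_E Uz (fun m => is_derive_Gam a k b m Uz).
have {}h2 := is_derive_near oU Uz (fun t Ut => esym (df_nabla k b Ut)) h2.
have e1 := etrans (dot_nabla_perp l Uz h1)
  (dot_derive_sum_JE k l (fun m => hcoef a b m z) (fun m => dhcoef k a b m z)
     Uz).
have e2 := etrans (dot_sff l (nabla (e k) (e a)) (e b) Uz)
  (etrans (congr1 (fun v => dot ('D_v (push f (e b)) z) (JE l z))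
     (nablaE k a Uz))
   (dot_derive_E_sum b l (fun m => Gam k a m z) Uz)).
have e3 := etrans (dot_sff l (e a) (nabla (e k) (e b)) Uz)
  (etrans (congr1 (fun v => dot v (JE l z)) (@derive_val _ _ _ _ _ _ _ h2))
   (dot_derive_sum_E a l (fun m => Gam k b m z) _ Uz)).
apply: etrans (congr2 (fun p q => p - q)
  (congr2 (fun p q => p - q) e1 e2) e3) _.
rewrite /covh -!addrA; congr (_ + _).
rewrite -!sumrN -!big_split /=; apply: eq_bigr => m _.
rewrite (Gam_antisym k l m Uz).
by move: (Gam _ _ _ _) (Gam _ _ _ _) (Gam _ _ _ _) (hcoef _ _ _ _)
  (hcoef _ _ _ _) (hcoef _ _ _ _) (omcoef _ _ _ _) => *; ring.
Qed.

Lemma push_shape z a c : U z ->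
  push f (Defs.shape f nabla e (Jpush f (e c)) (e a)) z =
  \sum_m hcoef a m c z *: E m z.
Proof.
move=> Uz; rewrite /push /Defs.shape linear_sum; apply: eq_bigr => m _.
by rewrite [LHS]linearZ /=; congr (_ *: _); exact: hcE.
Qed.

Lemma dot_G_shape z k a c l : U z ->
  dot (Gtensor (f z) (E k z)
    (push f (Defs.shape f nabla e (Jpush f (e c)) (e a)) z)) (JE l z) =
  \sum_m hcoef a m c z * omcoef k m l z.
Proof.
move=> Uz; apply: etrans (dot_Gtensor _ _ (f_sphere z) _) _.
  exact: dot_df_f.
rewrite push_shape// cross_sumr dot_suml; apply: eq_bigr => m _.
by rewrite (crossZr (hcoef a m c z)) (dotZl (hcoef a m c z)).
Qed.

Lemma TcE z k a b i : U z -> Tc f nabla e k a b i z =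
  Tfull (fun i j k => omcoef i j k z) (fun i j k => hcoef i j k z)
    (fun k a b i => covh k a b i z) k a b i.
Proof.
move=> Uz; have lin (p q r s t : 'rV[R]_7) : dot (p - 4^-1 *: (q + r + s)) t =
    dot p t - 4^-1 * (dot q t + dot r t + dot s t).
  by rewrite dotBl dotZl !dotDl.
apply: etrans (lin _ _ _ _ _) _; rewrite /Tfull /dsff /Tcorr.
have e1 := dot_G_shape k a b i Uz; have e2 := dot_G_shape a b k i Uz.
have e3 := dot_G_shape b k a i Uz.
apply: etrans (congr2 (fun p q => p - 4^-1 * q) (dot_nabla_sff k a b i Uz)
  (congr2 +%R (congr2 +%R e1 e2) e3)) _.
congr (_ - _ * _); rewrite -!big_split /=; apply: eq_bigr => m _.
(* The shape operators yield h with the summation index in the middle, whereas [Tcorr] has it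
   last. *)
rewrite (hcoef_swap23 a m b Uz) (hcoef_swap23 b m k Uz) (hcoef_swap23 k m a Uz).
rewrite (hcoef_swap12 k a m Uz).
by move: (hcoef _ _ _ _) (hcoef _ _ _ _) (hcoef _ _ _ _) (omcoef _ _ _ _) (omcoef _ _ _ _)
  (omcoef _ _ _ _) => *; ring.
Qed.

Lemma ScE z i j : U z ->
  Sc f nabla e i j z = \sum_a \sum_b hcoef a b i z * hcoef a b j z.
Proof.
move=> Uz; apply: eq_bigr => a _; apply: eq_bigr => b _.
by rewrite (hcE a b i Uz) (hcE a b j Uz).
Qed.

Lemma dot_sff_nabla z a b k i : U z ->
  dot (sff f nabla (e a) (e b) z) (Jpush f (nabla (e k) (e i)) z) =
  \sum_m Gam k i m z * hcoef a b m z.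
Proof.
move=> Uz.
have -> : Jpush f (nabla (e k) (e i)) z = \sum_m Gam k i m z *: JE m z.
  rewrite /Jpush /acs [push f (nabla _ _) z]df_nabla// cross_sumr.
  by apply: eq_bigr => m _; rewrite (crossZr (Gam k i m z)).
rewrite dot_sumr; apply: eq_bigr => m _.
by rewrite (dotZr _ _ (JE m z)); congr (_ * _); exact: hcE.
Qed.

Lemma dScE z i j k : U z -> dSc f nabla e i j k z =
  \sum_a \sum_b
    (covh k a b i z * hcoef a b j z + hcoef a b i z * covh k a b j z).
Proof.
move=> Uz.
pose Sh i j t := \sum_a \sum_b hcoef a b i t * hcoef a b j t.
have hS : is_derive z (e k z) (Sh i j)
    (\sum_a \sum_b
       (dhcoef k a b i z * hcoef a b j z + hcoef a b i z * dhcoef k a b j z)).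
  apply: is_derive_fsum => a; apply: is_derive_fsum => b.
  by apply: is_derive_prod; exact: is_derive_hcoef.
have {}hS := is_derive_near oU Uz (fun t Ut => esym (ScE i j Ut)) hS.
have e1 : Stensor f nabla e (nabla (e k) (e i)) (e j) z =
    \sum_m Gam k i m z * Sh m j z.
  transitivity (\sum_a \sum_b \sum_m
      Gam k i m z * (hcoef a b m z * hcoef a b j z)).
    apply: eq_bigr => a _; apply: eq_bigr => b _; rewrite dot_sff_nabla//.
    rewrite -[X in _ * X]/(hc f nabla e a b j z) hcE// mulr_suml.
    by apply: eq_bigr => m _; rewrite mulrA.
  under eq_bigr do rewrite exchange_big /=.
  rewrite exchange_big; apply: eq_bigr => m _ /=; rewrite mulr_sumr.
  by apply: eq_bigr => a _; rewrite mulr_sumr.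
have e2 : Stensor f nabla e (e i) (nabla (e k) (e j)) z =
    \sum_m Gam k j m z * Sh i m z.
  transitivity (\sum_a \sum_b \sum_m
      Gam k j m z * (hcoef a b i z * hcoef a b m z)).
    apply: eq_bigr => a _; apply: eq_bigr => b _; rewrite dot_sff_nabla//.
    rewrite -[X in X * _]/(hc f nabla e a b i z) hcE// mulr_sumr.
    by apply: eq_bigr => m _; rewrite mulrCA.
  under eq_bigr do rewrite exchange_big /=.
  rewrite exchange_big; apply: eq_bigr => m _ /=; rewrite mulr_sumr.
  by apply: eq_bigr => a _; rewrite mulr_sumr.
apply: etrans (congr2 (fun p q => p - q) (congr2 (fun p q => p - q)
  (@derive_val _ _ _ _ _ _ _ hS) e1) e2) _.
exact: (covariant_derivative_squares (@sum3E R) (fun i j k => hcoef i j k z)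
  (fun a b i => dhcoef k a b i z) i j (fun a b => Gam_antisym k a b Uz)).
Qed.

Lemma hcoef_symmetric_traceless z : U z ->
  symmetric_traceless (fun i j k => hcoef i j k z).
Proof.
move=> Uz; split=> *.
- exact: hcoef_swap12.
- exact: hcoef_swap23.
- exact: hcoef_trace.
Qed.

Lemma PcE z i j k : U z -> Pc f nabla e i j k z = \sum_a \sum_b hcoef a b i z *
  Tfull (fun i j k => omcoef i j k z) (fun i j k => hcoef i j k z)
    (fun k a b i => covh k a b i z) a b j k.
Proof.
move=> Uz; apply: eq_bigr => a _; apply: eq_bigr => b _.
by rewrite (hcE a b i Uz) (TcE a b j k Uz).
Qed.

Lemma DcE z i j k : U z -> Dc f nabla e i j k z = 4^-1 *
  \sum_m (omcoef k i m z * Sc f nabla e m j z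
          + omcoef k j m z * Sc f nabla e i m z).
Proof.
move=> Uz; congr (_ * _); apply: eq_bigr => m _.
by rewrite (omegacE k i m Uz) (omegacE k j m Uz).
Qed.

Lemma Pc_swap23 z i j k : U z -> Pc f nabla e i j k z = Pc f nabla e i k j z.
Proof.
move=> Uz; apply: etrans (PcE i j k Uz) (etrans _ (esym (PcE i k j Uz))).
apply: (P_swap23 (@sum3E R) ord3_ind (omcoef_volume Uz)
  (hcoef_symmetric_traceless Uz)) => *; exact: covh_swap34.
Qed.

Lemma dSc_PD z i j k : U z -> dSc f nabla e i j k z =
  Pc f nabla e i j k z + Pc f nabla e j i k z + Dc f nabla e i j k z.
Proof.
move=> Uz; rewrite dScE// (PcE i j k Uz) (PcE j i k Uz) (DcE i j k Uz).
under [X in _ + _ * X]eq_bigr do rewrite (ScE _ j Uz) (ScE i _ Uz).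
apply: (covariant_derivative_SE (@sum3E R) ord3_ind (omcoef_volume Uz)
  (hcoef_symmetric_traceless Uz)) => *.
- exact: covh_swap23.
- exact: covh_swap34.
- exact: codazzi_frame.
Qed.

Lemma sum_dSc z : U z ->
  \sum_i \sum_j \sum_k dSc f nabla e i j k z * dSc f nabla e i k j z =
    (\sum_i \sum_j \sum_k Pc f nabla e i j k z ^+ 2)
    + 3 * (\sum_i \sum_j \sum_k Pc f nabla e i j k z * Pc f nabla e j i k z)
    + 2^-1 * (\sum_i \sum_j Ac f nabla e i j z * Sc f nabla e i j z)
    + 16^-1 * (s_ f nabla e z ^+ 2 - 3 * q_ f nabla e z).
Proof.
move=> Uz.
have S12 i j : Sc f nabla e i j z = Sc f nabla e j i z.
  by apply: eq_bigr => a _; apply: eq_bigr => b _; rewrite mulrC.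
have := quadratic_identity (@sum3E R) (omcoef_volume Uz) S12
  (fun i j k => Pc_swap23 i j k Uz).
have -> : s_ f nabla e z = \sum_i Sc f nabla e i i z.
  by apply: eq_bigr => i _; rewrite mxE.
have -> : q_ f nabla e z =
    \sum_i \sum_j Sc f nabla e i j z * Sc f nabla e j i z.
  by apply: eq_bigr => i _; rewrite mxE; apply: eq_bigr => j _; rewrite !mxE.
move=> Q; apply: etrans (etrans _ Q) _.
  apply: eq_bigr => i _; apply: eq_bigr => j _; apply: eq_bigr => k _.
  by rewrite (dSc_PD i j k Uz) (dSc_PD i k j Uz) !DcE.
congr (_ + _ * _ + _); apply: eq_bigr => i _; apply: eq_bigr => j _.
have WE a b : Wc f nabla e a b z =
    \sum_c \sum_d omcoef a c d z * Pc f nabla e c d b z.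
  by apply: eq_bigr => c _; apply: eq_bigr => d _; rewrite (omegacE a c d Uz).
by rewrite /Ac !WE.
Qed.

End LagrangianFrame.

Theorem lemma3p1 (R : realType) (M : topologicalType) (MS : manifold3 R M)
    (F : M -> 'rV[R]_7) (hF : lagrangian MS F)
    (c : chart R M) (hc_atlas : atlas MS c)
    (U : set 'rV[R]_3) (hU : open U) (hUc : U `<=` chart_img c)
    (nabla : ('rV[R]_3 -> 'rV[R]_3) -> ('rV[R]_3 -> 'rV[R]_3) ->
             'rV[R]_3 -> 'rV[R]_3)
    (hnabla : levi_civita U (induced_metric (local_rep F c)) nabla)
    (e : 'I_3 -> 'rV[R]_3 -> 'rV[R]_3)
    (he : oriented_orthonormal_frame (local_rep F c) U e)
    (x : 'rV[R]_3) (hx : U x) :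
  let f := local_rep F c in
  let S i j := Sc f nabla e i j x in
  let dS i j k := dSc f nabla e i j k x in
  let P i j k := Pc f nabla e i j k x in
  let A i j := Ac f nabla e i j x in
  let D i j k := Dc f nabla e i j k x in
  let s := s_ f nabla e x in
  let q := q_ f nabla e x in
  (forall i j k, dS i j k = P i j k + P j i k + D i j k) /\
  \sum_i \sum_j \sum_k dS i j k * dS i k j =
    (\sum_i \sum_j \sum_k P i j k ^+ 2)
    + 3 * (\sum_i \sum_j \sum_k P i j k * P j i k)
    + 2^-1 * (\sum_i \sum_j A i j * S i j)
    + 16^-1 * (s ^+ 2 - 3 * q).
Proof.
move=> f; have [[F_sphere F_smooth F_inj] F_lag] := hF.
have sf : smooth_on U f by apply: smooth_sub hUc _; exact: F_smooth.
(* This holds for all z, even outside the chart image, since F maps the whole of M to the sphere. *)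
have f_sphere z : dot (f z) (f z) = 1 by exact: F_sphere.
have f_inj z : U z -> injective ('d f z).
  by move=> Uz; apply: F_inj => //; exact: hUc.
have f_lag z : U z -> forall u v, dot (cross (f z) ('d f z u)) ('d f z v) = 0.
  move=> Uz u v; have /= Lz := F_lag c hc_atlas z (hUc z Uz).
  have : [set acs (f z) ('d f z v) | v in [set: 'rV[R]_3]]
    (cross (f z) ('d f z u)) by exists u.
  by rewrite Lz => -[_]; exact.
split=> [i j k|]; first exact: (dSc_PD hU sf f_sphere f_inj f_lag hnabla he).
exact: (sum_dSc hU sf f_sphere f_inj f_lag hnabla he).
Qed.
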